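(* Let $g(h)=\sup_{P\in\mathcal C(h)}\varrho(P)$. There exist absolute constants $c_1,c_2>0$ such that for every integer $h\geq 1$, \[ c_1\, h^{1/3}\;\le\; g(h)\;\le\; c_2\, h^{1/2}. \]
   Context: For $h\in\mathbb N$, $\mathcal C(h)$ denotes the family of polygonal domains $P=P_0\setminus\bigcup_{i=1}^h \operatorname{int}(P_i)$, where $P_0$ is a convex polygon in the plane and $P_1,\dots,P_h$ (the holes) are pairwise disjoint convex polygons contained in the interior of $P_0$. For $s,t\in P$, $|st|$ is the Euclidean distance and ${\rm geod}(s,t)$ is the infimum of the Euclidean lengths of polygonal paths from $s$ to $t$ contained in $P$. The Euclidean diameter is ${\rm diam}_2(P)=\sup_{s,t\in P}|st|$, the geodesic diameter is ${\rm diam}_g(P)=\sup_{s,t\in P}{\rm geod}(s,t)$, and the distortion is $\varrho(P)={\rm diam}_g(P)/{\rm diam}_2(P)$. *)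

(* Defs.v *)
From Stdlib Require Import Reals Lra.
From Coquelicot Require Import Coquelicot.
Open Scope R_scope.

Definition point : Type := (R * R)%type.

Definition dist (p q : point) : R :=
  sqrt ((fst p - fst q) ^ 2 + (snd p - snd q) ^ 2).

Fixpoint fsum (f : nat -> R) (n : nat) : R :=
  match n with
  | O => 0
  | S k => fsum f k + f k
  end.

Definition in_hull (n : nat) (v : nat -> point) (p : point) : Prop :=
  exists w : nat -> R,
    (forall i, (i < n)%nat -> 0 <= w i) /\
    fsum w n = 1 /\
    fst p = fsum (fun i => w i * fst (v i)) n /\
    snd p = fsum (fun i => w i * snd (v i)) n.

Definition interior (S : point -> Prop) (p : point) : Prop :=
  exists r, 0 < r /\ forall q, dist p q < r -> S q.

Definition convex_polygon (S : point -> Prop) : Prop :=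
  (exists (n : nat) (v : nat -> point), forall p, S p <-> in_hull n v p) /\
  (exists p, interior S p).

Definition in_C (h : nat) (P : point -> Prop) : Prop :=
  exists (P0 : point -> Prop) (H : nat -> point -> Prop),
    convex_polygon P0 /\
    (forall i, (i < h)%nat -> convex_polygon (H i)) /\
    (forall i j, (i < h)%nat -> (j < h)%nat -> i <> j ->
       forall p, ~ (H i p /\ H j p)) /\
    (forall i, (i < h)%nat -> forall p, H i p -> interior P0 p) /\
    (forall p, P p <-> (P0 p /\ forall i, (i < h)%nat -> ~ interior (H i) p)).

Definition segment (p q : point) (x : point) : Prop :=
  exists l, 0 <= l <= 1 /\
    fst x = (1 - l) * fst p + l * fst q /\
    snd x = (1 - l) * snd p + l * snd q.

Fixpoint path_in (P : point -> Prop) (s : point) (l : list point) (t : point)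
  : Prop :=
  match l with
  | nil => forall x, segment s t x -> P x
  | cons x l' => (forall y, segment s x y -> P y) /\ path_in P x l' t
  end.

Fixpoint path_len (s : point) (l : list point) (t : point) : R :=
  match l with
  | nil => dist s t
  | cons x l' => dist s x + path_len x l' t
  end.

Definition geod (P : point -> Prop) (s t : point) : Rbar :=
  Glb_Rbar (fun r => exists l, path_in P s l t /\ r = path_len s l t).

Definition diam2 (P : point -> Prop) : Rbar :=
  Lub_Rbar (fun r => exists s t, P s /\ P t /\ r = dist s t).

(** Geodesic diameter: sup over s,t in P of geod(s,t) (as an Rbar supremum
    of the family of Rbar values). *)
Definition diamg (P : point -> Prop) : Rbar :=
  Lub_Rbar (fun r => exists s t, P s /\ P t /\ Rbar_le r (geod P s t)).

(** Distortion rho(P) = diam_g(P) / diam_2(P)  (diam_2(P) is a finite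
    positive real for P in C(h)). *)
Definition distortion (P : point -> Prop) : Rbar :=
  Rbar_mult (diamg P) (Finite (/ real (diam2 P))).

Definition g (h : nat) : Rbar :=
  Lub_Rbar (fun r => exists P, in_C h P /\ Rbar_le r (distortion P)).

(* Main.v *)
From Stdlib Require Import Reals Lra Lia Psatz List ZArith Classical ClassicalEpsilon.
From Coquelicot Require Import Coquelicot.
Require Import Defs.
Open Scope R_scope.

(** Upper bound. Fix [m ~ sqrt h] and a shear [X = x + (j/m) y]. From any point walk to the right;
    on meeting a hole slide along its boundary to its top or bottom vertex, whichever makes [X]
    increase. Each exit vertex is used once, and the walk ends on the outer boundary. The length is
    [O(m)] times the diameter plus the lengths of the boundary pieces almost orthogonal to [grad X];
    summed over the [m] values of [j] these pieces telescope to [O(1)] diameters per hole, so some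
    [j] costs only [O(h / m)] diameters.

    Lower bound. Surround a point by [q^2] nested regular [8q]-gons with radii between 1 and 2,
    consecutive ones rotated by half a side, every side being a thin rectangular hole that stops
    short of the corners. A path outwards crosses each polygon near a corner, and corners of
    consecutive polygons are at distance [Omega(1/q)]; so [8 q^3] holes force length [Omega(q)]. *)

(** * Points and finite sums *)

(** Sliding gains nothing in [X] along edges parallel to its level lines, and a single hole may have
    such edges as long as the diameter; no direction is safe in advance, so it is chosen by
    averaging. A shear, unlike a rotation, leaves [y] and the horizontal rays unchanged. The loss at
    a hole is then the difference of heights of its minimisers of [x + (j/m) y] and
    [x + ((j+2)/m) y], which telescopes in [j]. Taking [m ~ sqrt h] balances [m] against [h / m].
    All walks end at one fixed vertex, so two of them, one reversed, join any two points.

    In the lower bound the radii grow by [1 / q^2] because the corners of a regular [8q]-gon stick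
    out by a relative amount of this order, and the sides of the next, rotated polygon face these
    corners and have to clear them. *)

Definition lin (u p : point) : R := fst u * fst p + snd u * snd p.

Lemma dist_nonneg (p q : point) : 0 <= dist p q.
Proof. apply sqrt_pos. Qed.

Lemma dist_sym (p q : point) : dist p q = dist q p.
Proof. unfold dist; f_equal; ring. Qed.

Lemma dist_triangle (p x q : point) : dist p q <= dist p x + dist x q.
Proof.
  pose proof (triangle (fst p) (snd p) (fst q) (snd q) (fst x) (snd x)) as Ht.
  unfold dist_euc, Rsqr in Ht; unfold dist.
  replace ((fst p - fst q) ^ 2) with ((fst p - fst q) * (fst p - fst q)) by ring.
  replace ((snd p - snd q) ^ 2) with ((snd p - snd q) * (snd p - snd q)) by ring.
  replace ((fst p - fst x) ^ 2) with ((fst p - fst x) * (fst p - fst x)) by ring.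
  replace ((snd p - snd x) ^ 2) with ((snd p - snd x) * (snd p - snd x)) by ring.
  replace ((fst x - fst q) ^ 2) with ((fst x - fst q) * (fst x - fst q)) by ring.
  replace ((snd x - snd q) ^ 2) with ((snd x - snd q) * (snd x - snd q)) by ring.
  exact Ht.
Qed.

Lemma dist_le_l1 (p q : point) :
  dist p q <= Rabs (fst p - fst q) + Rabs (snd p - snd q).
Proof.
  unfold dist; apply Rsqr_incr_0_var.
  - rewrite Rsqr_sqrt by (apply Rplus_le_le_0_compat; apply pow2_ge_0).
    unfold Rsqr; rewrite <- (pow2_abs (fst p - fst q)), <- (pow2_abs (snd p - snd q)).
    pose proof (Rabs_pos (fst p - fst q)); pose proof (Rabs_pos (snd p - snd q)); nra.
  - pose proof (Rabs_pos (fst p - fst q)); pose proof (Rabs_pos (snd p - snd q)); lra.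
Qed.

Lemma lin_unit_le_dist (u p q : point) :
  fst u ^ 2 + snd u ^ 2 = 1 -> Rabs (lin u p - lin u q) <= dist p q.
Proof.
  intros Hu; unfold dist.
  rewrite <- sqrt_Rsqr_abs; apply sqrt_le_1_alt; unfold Rsqr, lin.
  rewrite <- (Rmult_1_l ((fst p - fst q) ^ 2 + (snd p - snd q) ^ 2)), <- Hu.
  assert (0 <= (fst u * (snd p - snd q) - snd u * (fst p - fst q)) ^ 2) by apply pow2_ge_0.
  lra.
Qed.

Lemma abs_fst_le_dist (p q : point) : Rabs (fst p - fst q) <= dist p q.
Proof.
  pose proof (lin_unit_le_dist (1, 0) p q) as H; unfold lin in H; simpl in H.
  replace (1 * fst p + 0 * snd p - (1 * fst q + 0 * snd q)) with (fst p - fst q) in H by ring.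
  apply H; ring.
Qed.

Lemma abs_snd_le_dist (p q : point) : Rabs (snd p - snd q) <= dist p q.
Proof.
  pose proof (lin_unit_le_dist (0, 1) p q) as H; unfold lin in H; simpl in H.
  replace (0 * fst p + 1 * snd p - (0 * fst q + 1 * snd q)) with (snd p - snd q) in H by ring.
  apply H; ring.
Qed.

Lemma fsum_ext (f f' : nat -> R) (n : nat) :
  (forall i, (i < n)%nat -> f i = f' i) -> fsum f n = fsum f' n.
Proof.
  induction n as [|n IH]; simpl; intros H; auto.
  rewrite IH, H; auto.
Qed.

Lemma fsum_le (f f' : nat -> R) (n : nat) :
  (forall i, (i < n)%nat -> f i <= f' i) -> fsum f n <= fsum f' n.
Proof.
  induction n as [|n IH]; simpl; intros H; [lra|].
  apply Rplus_le_compat; auto.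
Qed.

Lemma fsum_lincomb (a b : R) (f f' : nat -> R) (n : nat) :
  fsum (fun i => a * f i + b * f' i) n = a * fsum f n + b * fsum f' n.
Proof. induction n as [|n IH]; simpl; [ring|rewrite IH; ring]. Qed.

Lemma fsum_const (c : R) (n : nat) : fsum (fun _ => c) n = INR n * c.
Proof. induction n as [|n IH]; [simpl; ring|]. rewrite S_INR; simpl; rewrite IH; ring. Qed.

Lemma fsum_scal (a : R) (f : nat -> R) (n : nat) :
  fsum (fun i => a * f i) n = a * fsum f n.
Proof. induction n as [|n IH]; simpl; [ring|rewrite IH; ring]. Qed.

Lemma fsum_exchange (f : nat -> nat -> R) (n m : nat) :
  fsum (fun i => fsum (f i) m) n = fsum (fun j => fsum (fun i => f i j) n) m.
Proof.
  induction n as [|n IH]; simpl.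
  - rewrite fsum_const; ring.
  - rewrite IH. rewrite <- (Rmult_1_l (fsum (fun j => fsum (fun i => f i j) n) m)).
    rewrite <- (Rmult_1_l (fsum (f n) m)), <- fsum_lincomb.
    apply fsum_ext; intros; ring.
Qed.

Lemma fsum_indicator (f : nat -> R) (i n : nat) :
  fsum (fun j => (if Nat.eqb j i then 1 else 0) * f j) n = if Nat.ltb i n then f i else 0.
Proof.
  induction n as [|n IH]; simpl; auto.
  rewrite IH.
  destruct (Nat.ltb_spec i n), (Nat.ltb_spec i (S n)), (Nat.eqb_spec n i);
    try lia; subst; ring.
Qed.

Lemma fsum_gain (f f' : nat -> R) (n k : nat) (e : R) :
  (k < n)%nat -> (forall i, (i < n)%nat -> f i <= f' i) -> f k + e <= f' k ->
  fsum f n + e <= fsum f' n.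
Proof.
  intros Hk Hle He; induction n as [|n IH]; [lia|]; simpl.
  destruct (Nat.eq_dec k n) as [->|Hn].
  - assert (fsum f n <= fsum f' n) by (apply fsum_le; auto). lra.
  - assert (fsum f n + e <= fsum f' n) by (apply IH; auto; lia).
    assert (f n <= f' n) by auto. lra.
Qed.

Lemma fsum_le_average (f : nat -> R) (n : nat) :
  (1 <= n)%nat -> exists j, (j < n)%nat /\ INR n * f j <= fsum f n.
Proof.
  intros Hn.
  destruct (classic (exists j, (j < n)%nat /\ INR n * f j <= fsum f n)) as [H|H]; auto.
  exfalso.
  assert (Hall : forall j, (j < n)%nat -> fsum f n < INR n * f j).
  { intros j Hj; apply Rnot_le_lt; intros Hle; apply H; exists j; auto. }
  assert (Hpos : 0 < INR n) by (apply lt_0_INR; lia).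
  assert (Hlt : fsum (fun _ => fsum f n / INR n) n + 
     (f 0%nat - fsum f n / INR n) <= fsum f n).
  { apply (fsum_gain _ _ n 0); [lia| |lra].
    intros i Hi. apply Rmult_le_reg_l with (INR n); auto.
    replace (INR n * (fsum f n / INR n)) with (fsum f n) by (field; lra).
    specialize (Hall i Hi); lra. }
  rewrite fsum_const in Hlt.
  replace (INR n * (fsum f n / INR n)) with (fsum f n) in Hlt by (field; lra).
  assert (f 0%nat <= fsum f n / INR n) by lra.
  assert (INR n * f 0%nat <= fsum f n).
  { replace (fsum f n) with (INR n * (fsum f n / INR n)) by (field; lra).
    apply Rmult_le_compat_l; lra. }
  specialize (Hall 0%nat ltac:(lia)); lra.
Qed.

Lemma list_argmin {A : Type} (f : A -> R) (Q : A -> Prop) (L : list A) :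
  (exists x, In x L /\ Q x) ->
  exists x, In x L /\ Q x /\ forall y, In y L -> Q y -> f x <= f y.
Proof.
  induction L as [|a L IH]; intros [x [Hx HQ]]; [destruct Hx|].
  destruct (classic (exists x, In x L /\ Q x)) as [HL|HL].
  - destruct (IH HL) as [m [Hm [HQm Hmin]]].
    destruct (classic (Q a /\ f a <= f m)) as [[Ha Hle]|Hn].
    + exists a; simpl; repeat split; auto.
      intros y [<-|Hy] HQy; [lra|]. specialize (Hmin y Hy HQy); lra.
    + exists m; simpl; repeat split; auto.
      intros y [<-|Hy] HQy; auto.
      apply Rnot_lt_le; intros Hlt; apply Hn; split; auto; lra.
  - exists a; simpl.
    assert (Hno : forall y, In y L -> ~ Q y) by (intros y Hy HQy; apply HL; eauto).
    destruct Hx as [<-|Hx]; [|exfalso; eapply Hno; eauto].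
    repeat split; auto. intros y [<-|Hy] HQy; [lra|]. exfalso; eapply Hno; eauto.
Qed.

Lemma functional_choice {A B : Type} (Q : A -> B -> Prop) :
  (forall x, exists y, Q x y) -> exists f, forall x, Q x (f x).
Proof.
  intros H; exists (fun x => proj1_sig (constructive_indefinite_description _ (H x))).
  intros x; apply proj2_sig.
Qed.

Lemma segment_lin (u p q x : point) :
  segment p q x -> exists l, 0 <= l <= 1 /\ lin u x = (1 - l) * lin u p + l * lin u q.
Proof.
  intros [l [Hl [Hx Hy]]]; exists l; split; auto.
  unfold lin; rewrite Hx, Hy; ring.
Qed.

Lemma segment_sym (p q x : point) : segment p q x -> segment q p x.
Proof. intros [l [Hl [Hx Hy]]]; exists (1 - l); repeat split; try lra. Qed.

(** [hull_of L S] records what is used of "[S] is the convex hull of the finite list [L]". *)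
Definition hull_of (L : list point) (S : point -> Prop) : Prop :=
  (forall v, In v L -> S v) /\
  (forall p q x, S p -> S q -> segment p q x -> S x) /\
  (forall u c, (forall v, In v L -> lin u v <= c) -> forall p, S p -> lin u p <= c).

Lemma convex_polygon_hull (S : point -> Prop) :
  convex_polygon S -> exists L, hull_of L S.
Proof.
  intros [[n [v Hv]] _]; exists (map v (seq 0 n)).
  split; [|split].
  - intros x Hx; apply in_map_iff in Hx; destruct Hx as [i [<- Hi]].
    apply in_seq in Hi; apply Hv.
    exists (fun j => if Nat.eqb j i then 1 else 0); repeat split.
    + intros j _; destruct (Nat.eqb j i); lra.
    + rewrite (fsum_ext _ (fun j => (if Nat.eqb j i then 1 else 0) * (fun _ => 1) j))
        by (intros; simpl; ring).
      rewrite fsum_indicator. destruct (Nat.ltb_spec i n); [auto|lia].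
    + rewrite (fsum_indicator (fun j => fst (v j))). destruct (Nat.ltb_spec i n); [auto|lia].
    + rewrite (fsum_indicator (fun j => snd (v j))). destruct (Nat.ltb_spec i n); [auto|lia].
  - intros p q x Hp Hq [l [Hl [Hx Hy]]]; apply Hv.
    apply Hv in Hp; apply Hv in Hq.
    destruct Hp as [w [Hw [Hw1 [Hpx Hpy]]]], Hq as [z [Hz [Hz1 [Hqx Hqy]]]].
    exists (fun i => (1 - l) * w i + l * z i); repeat split.
    + intros i Hi; specialize (Hw i Hi); specialize (Hz i Hi); nra.
    + rewrite fsum_lincomb, Hw1, Hz1; ring.
    + rewrite Hx, Hpx, Hqx, <- fsum_lincomb; apply fsum_ext; intros; ring.
    + rewrite Hy, Hpy, Hqy, <- fsum_lincomb; apply fsum_ext; intros; ring.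
  - intros u c Hu p Hp; apply Hv in Hp; destruct Hp as [w [Hw [Hw1 [Hpx Hpy]]]].
    unfold lin; rewrite Hpx, Hpy, <- fsum_lincomb.
    replace c with (c * fsum w n) by (rewrite Hw1; ring).
    rewrite <- fsum_scal; apply fsum_le; intros i Hi.
    specialize (Hw i Hi).
    assert (Hc : lin u (v i) <= c) by (apply Hu, in_map, in_seq; lia).
    unfold lin in Hc; nra.
Qed.

(** The zero functional is vacuously at most [-1] on an empty list, hence would be so at [p]. *)
Lemma hull_of_nonempty (L : list point) (S : point -> Prop) (p : point) :
  hull_of L S -> S p -> exists v, In v L.
Proof.
  intros [_ [_ HL]] Hp; destruct L as [|v L]; [exfalso|exists v; simpl; auto].
  assert (H : lin (0, 0) p <= -1) by (apply HL; [intros v []|auto]).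
  unfold lin in H; simpl in H; lra.
Qed.

Lemma hull_argmax (L : list point) (S : point -> Prop) (u p : point) :
  hull_of L S -> S p ->
  exists T, In T L /\ (forall v, In v L -> lin u v <= lin u T) /\ forall q, S q -> lin u q <= lin u T.
Proof.
  intros HL Hp; destruct (hull_of_nonempty L S p HL Hp) as [v0 Hv0].
  destruct (list_argmin (fun v => - lin u v) (fun _ => True) L) as [T [HT [_ Hmin]]]; eauto.
  exists T; split; auto.
  assert (H : forall v, In v L -> lin u v <= lin u T)
    by (intros v Hv; specialize (Hmin v Hv I); lra).
  split; auto. apply HL; auto.
Qed.

Lemma max_not_interior (S : point -> Prop) (u x : point) :
  (fst u <> 0 \/ snd u <> 0) -> (forall q, S q -> lin u q <= lin u x) -> ~ interior S x.
Proof.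
  intros Hu Hmax [r [Hr Hin]].
  assert (Hpos : 0 < fst u ^ 2 + snd u ^ 2) by (destruct Hu; nra).
  (* Moving by [e * u] stays within [r / 2] in the l1 norm and raises [lin u] by [e * |u|^2]. *)
  set (e := r / (2 * (Rabs (fst u) + Rabs (snd u) + 1))).
  pose proof (Rabs_pos (fst u)); pose proof (Rabs_pos (snd u)).
  assert (He : 0 < e) by (apply Rdiv_lt_0_compat; lra).
  assert (Hmove : lin u (fst x + e * fst u, snd x + e * snd u) <= lin u x).
  { apply Hmax, Hin; eapply Rle_lt_trans; [apply dist_le_l1|]; simpl.
    replace (fst x - (fst x + e * fst u)) with (- (e * fst u)) by ring.
    replace (snd x - (snd x + e * snd u)) with (- (e * snd u)) by ring.
    rewrite !Rabs_Ropp, !Rabs_mult, (Rabs_pos_eq e) by lra.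
    assert (e * (2 * (Rabs (fst u) + Rabs (snd u) + 1)) = r) by (unfold e; field; lra).
    nra. }
  unfold lin in Hmove; simpl in Hmove; nra.
Qed.

Lemma interior_in (S : point -> Prop) (x : point) : interior S x -> S x.
Proof.
  intros [r [Hr H]]; apply H; unfold dist.
  replace ((fst x - fst x) ^ 2 + (snd x - snd x) ^ 2) with 0 by ring.
  rewrite sqrt_0; auto.
Qed.

Lemma interior_vertex_above (L : list point) (S : point -> Prop) (u x : point) :
  hull_of L S -> (fst u <> 0 \/ snd u <> 0) -> interior S x ->
  exists v, In v L /\ lin u x < lin u v.
Proof.
  intros HL Hu Hx.
  destruct (hull_argmax L S u x HL (interior_in _ _ Hx)) as [T [HT [_ Hmax]]].
  exists T; split; auto.
  destruct (Rle_lt_dec (lin u T) (lin u x)) as [Hle|]; auto; exfalso.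
  apply (max_not_interior S u x Hu); auto.
  intros q Hq; specialize (Hmax q Hq); lra.
Qed.

(** The homothety of centre [a] and ratio [l] maps the ball around [q] to a ball around [x]; below,
    [y] is the preimage of [z]. *)
Lemma interior_open_segment (S : point -> Prop) (a q x : point) (l : R) :
  (forall p q x, S p -> S q -> segment p q x -> S x) ->
  S a -> interior S q -> 0 < l <= 1 ->
  fst x = (1 - l) * fst a + l * fst q -> snd x = (1 - l) * snd a + l * snd q ->
  interior S x.
Proof.
  intros Hconv Ha [r [Hr Hin]] Hl Hx Hy; exists (l * r); split; [nra|].
  intros z Hz.
  set (y := (fst q + (fst z - fst x) / l, snd q + (snd z - snd x) / l)).
  apply (Hconv a y); auto.
  - apply Hin.
    replace (dist q y) with (dist x z / l).
    { apply Rmult_lt_reg_l with l; [lra|].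
      replace (l * (dist x z / l)) with (dist x z) by (field; lra); auto. }
    unfold dist, y; simpl fst; simpl snd.
    replace ((fst q - (fst q + (fst z - fst x) / l)) ^ 2 + (snd q - (snd q + (snd z - snd x) / l)) ^ 2)
      with (((fst x - fst z) ^ 2 + (snd x - snd z) ^ 2) * (/ l) ^ 2) by (field; lra).
    assert (0 < / l) by (apply Rinv_0_lt_compat; lra).
    rewrite sqrt_mult_alt by (apply Rplus_le_le_0_compat; apply pow2_ge_0).
    rewrite sqrt_pow2 by lra.
    reflexivity.
  - exists l; repeat split; try lra; unfold y; simpl;
      [rewrite Hx|rewrite Hy]; field; lra.
Qed.

(** * Paths along the boundary of a polygon *)

(** Upper bounds on [geod] are kept as explicit paths, since these can be concatenated and
    reversed. *)
Definition reach (P : point -> Prop) (s t : point) (r : R) : Prop :=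
  exists l, path_in P s l t /\ path_len s l t <= r.

Lemma reach_le (P : point -> Prop) (s t : point) (r r' : R) :
  reach P s t r -> r <= r' -> reach P s t r'.
Proof. intros [l [Hl Hr]] Hle; exists l; split; [auto|lra]. Qed.

Lemma reach_subset (P Q : point -> Prop) (s t : point) (r : R) :
  (forall x, P x -> Q x) -> reach P s t r -> reach Q s t r.
Proof.
  intros HPQ [l [Hl Hr]]; exists l; split; [|lra].
  clear Hr; revert s Hl; induction l as [|x l IH]; simpl; intros s Hl; [auto|].
  destruct Hl; auto.
Qed.

Lemma reach_segment (P : point -> Prop) (s t : point) :
  (forall x, segment s t x -> P x) -> reach P s t (dist s t).
Proof. intros H; exists nil; simpl; split; auto; lra. Qed.

Lemma reach_trans (P : point -> Prop) (s x t : point) (r r' : R) :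
  reach P s x r -> reach P x t r' -> reach P s t (r + r').
Proof.
  intros [l [Hl Hr]] [l' [Hl' Hr']]; exists (l ++ x :: l')%list.
  revert s r Hl Hr; induction l as [|y l IH]; simpl; intros s r Hl Hr.
  - split; [auto|lra].
  - destruct Hl as [Hs Hl].
    destruct (IH y (r - dist s y) Hl ltac:(lra)); split; [auto|lra].
Qed.

Lemma reach_sym (P : point -> Prop) (s t : point) (r : R) : reach P s t r -> reach P t s r.
Proof.
  intros [l [Hl Hr]]; revert s r Hl Hr; induction l as [|x l IH]; simpl; intros s r Hl Hr.
  - eapply reach_le; [apply reach_segment|rewrite dist_sym; exact Hr].
    intros y Hy; apply Hl, segment_sym, Hy.
  - destruct Hl as [Hs Hl].
    eapply reach_le; [eapply reach_trans; [apply (IH x _ Hl (Rle_refl _))|apply reach_segment]|].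
    + intros y Hy; apply Hs, segment_sym, Hy.
    + rewrite (dist_sym x s); lra.
Qed.

Lemma segment_in_face (S : point -> Prop) (u p q : point) :
  (forall p q x, S p -> S q -> segment p q x -> S x) ->
  (fst u <> 0 \/ snd u <> 0) -> S p -> S q -> lin u p = lin u q ->
  (forall x, S x -> lin u x <= lin u p) ->
  forall x, segment p q x -> S x /\ ~ interior S x.
Proof.
  intros Hconv Hu Hp Hq Heq Hmax x Hx; split; [exact (Hconv p q x Hp Hq Hx)|].
  apply (max_not_interior S u x Hu); intros z Hz.
  destruct (segment_lin u p q x Hx) as [l [_ ->]].
  rewrite <- Heq; specialize (Hmax z Hz); lra.
Qed.

(* Gift wrapping: from [a] the next vertex is the one of least [X]/[Y] slope above [a]; since
   the slopes stay nonnegative the walk is monotone in both coordinates [X] and [Y]. *)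
Lemma boundary_chain (L : list point) (S : point -> Prop) (u w : point) (A B : R) (T : point) :
  hull_of L S -> fst u * snd w - snd u * fst w <> 0 ->
  (forall p q, dist p q <= A * Rabs (lin u p - lin u q) + B * Rabs (lin w p - lin w q)) ->
  In T L -> (forall v, In v L -> lin w v <= lin w T) ->
  forall a rho, S a -> 0 <= rho ->
    (forall v, In v L -> rho * (lin w v - lin w a) <= lin u v - lin u a) ->
    reach (fun x => S x /\ ~ interior S x) a T
      (A * (lin u T - lin u a) + B * (lin w T - lin w a)).
Proof.
  intros HL Hdet Hdist HT HTmax.
  assert (HTS : S T) by (apply HL; auto).
  assert (HmaxS : forall q, S q -> lin w q <= lin w T) by (apply HL; auto).
  (* [M] contains the vertices still above [a]. Each vertex reached is removed from it, so [n]
     bounds the number of edges left. *)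
  assert (Hmain : forall n M a rho, (length M <= n)%nat ->
    (forall v, In v L -> lin w a < lin w v -> In v M) -> S a -> 0 <= rho ->
    (forall v, In v L -> rho * (lin w v - lin w a) <= lin u v - lin u a) ->
    reach (fun x => S x /\ ~ interior S x) a T
      (A * (lin u T - lin u a) + B * (lin w T - lin w a))).
  { induction n as [|n IH]; intros M a rho Hlen HM Ha Hrho Hsup.
    all: pose proof (HmaxS a Ha) as HaT; pose proof (Hsup T HT) as HuT.
    all: destruct (Rle_lt_dec (lin w T) (lin w a)) as [Htop|Htop].
    (* Here [a] is level with [T], and one segment inside the top face leads to [T]. *)
    1, 3: eapply reach_le; [apply reach_segment|].
    1, 3: apply (segment_in_face S w);
      [apply HL | destruct (Req_dec (fst w) 0); [right; intros Hw; apply Hdet; rewrite Hw, H; ring|auto]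
      | auto | auto | lra | intros x Hx; specialize (HmaxS x Hx); lra].
    1, 2: eapply Rle_trans; [apply Hdist|];
      rewrite (Rabs_minus_sym (lin u a)), (Rabs_minus_sym (lin w a)), !Rabs_pos_eq by nra; lra.
    - exfalso; specialize (HM T HT Htop); destruct M; simpl in *; [auto|lia].
    - destruct (list_argmin (fun v => (lin u v - lin u a) / (lin w v - lin w a))
        (fun v => lin w a < lin w v) L) as [v [Hv [Hva Hmin]]]; [eauto|].
      set (r := (lin u v - lin u a) / (lin w v - lin w a)) in *.
      assert (Hr : lin u v - lin u a = r * (lin w v - lin w a)) by (unfold r; field; lra).
      assert (Hrr : rho <= r).
      { apply Rmult_le_reg_r with (lin w v - lin w a); [lra|]. rewrite <- Hr; auto. }
      assert (HvS : S v) by (apply HL; auto).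
      assert (Hsup' : forall z, In z L -> r * (lin w z - lin w a) <= lin u z - lin u a).
      { intros z Hz; destruct (Rle_lt_dec (lin w z) (lin w a)) as [Hle|Hlt].
        - specialize (Hsup z Hz); nra.
        - specialize (Hmin z Hz Hlt).
          apply Rmult_le_compat_r with (r := lin w z - lin w a) in Hmin; [|lra].
          replace ((lin u z - lin u a) / (lin w z - lin w a) * (lin w z - lin w a))
            with (lin u z - lin u a) in Hmin by (field; lra).
          exact Hmin. }
      (* The functional [r * lin w - lin u] is constant on the segment from [a] to [v] and maximal
         there, so the segment lies on the boundary. *)
      assert (Hfunc : forall p, lin (r * fst w - fst u, r * snd w - snd u) p = r * lin w p - lin u p)
        by (intros p; unfold lin; simpl; ring).
      destruct (in_split v M (HM v Hv Hva)) as [M1 [M2 HMeq]].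
      eapply reach_le.
      + eapply (reach_trans _ a v T); [apply reach_segment|].
        * apply (segment_in_face S (r * fst w - fst u, r * snd w - snd u)); auto.
          -- apply HL.
          -- simpl. destruct (Req_dec (r * fst w - fst u) 0) as [H0|]; auto.
             right; intros H1; apply Hdet.
             replace (fst u) with (r * fst w) by lra. replace (snd u) with (r * snd w) by lra. ring.
          -- rewrite !Hfunc; lra.
          -- apply HL; intros z Hz; rewrite !Hfunc; specialize (Hsup' z Hz); lra.
        * apply (IH (M1 ++ M2)%list v r).
          -- rewrite HMeq in Hlen; rewrite length_app in *; simpl in Hlen; lia.
          -- intros z Hz Hlt. assert (Hin : In z M) by (apply HM; auto; lra).
             rewrite HMeq in Hin; apply in_elt_inv in Hin.
             destruct Hin as [<-|Hin]; [lra|auto].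
          -- auto.
          -- lra.
          -- intros z Hz; specialize (Hsup' z Hz); lra.
      + pose proof (Hdist a v) as Hd.
        rewrite (Rabs_minus_sym (lin u a)), (Rabs_minus_sym (lin w a)), !Rabs_pos_eq in Hd by nra.
        lra. }
  intros a rho; apply (Hmain (length L) L); auto.
Qed.

(* [a] minimises [lin u] among the points where the line [lin w = lin w p] meets the edges. *)
Lemma line_entry (L : list point) (S : point -> Prop) (u w p : point) :
  hull_of L S -> S p ->
  exists a rho, S a /\ lin w a = lin w p /\
    forall v, In v L -> rho * (lin w v - lin w a) <= lin u v - lin u a.
Proof.
  intros HL Hp.
  set (c := lin w p).
  (* The point of the segment from [v] to [z] on the line. All pairs of vertices on opposite sides
     are candidates, which avoids singling out the edges. *)
  set (cross := fun vz : point * point => let (v, z) := vz in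
    let l := (c - lin w v) / (lin w z - lin w v) in
    ((1 - l) * fst v + l * fst z, (1 - l) * snd v + l * snd z) : point).
  assert (Hcross : forall v z, lin w z < c < lin w v -> S v -> S z ->
    S (cross (v, z)) /\ lin w (cross (v, z)) = c /\
    (lin u (cross (v, z)) - lin u z) * (lin w v - lin w z) = (lin u v - lin u z) * (c - lin w z)).
  { intros v z Hc Hv Hz; unfold cross.
    set (l := (c - lin w v) / (lin w z - lin w v)).
    assert (Hl : l * (lin w z - lin w v) = c - lin w v) by (unfold l; field; lra).
    assert (HX : forall t, lin t ((1 - l) * fst v + l * fst z, (1 - l) * snd v + l * snd z) =
       (1 - l) * lin t v + l * lin t z) by (intros t; unfold lin; simpl; ring).
    split; [|split].
    - apply (proj1 (proj2 HL) v z); auto; exists l; simpl; repeat split; nra.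
    - rewrite HX; lra.
    - rewrite HX. replace (c - lin w z) with ((1 - l) * (lin w v - lin w z)) by lra. ring. }
  set (C := (filter (fun v => if Req_EM_T (lin w v) c then true else false) L ++
    map cross (filter (fun vz => if Rlt_dec (lin w (snd vz)) c then
        if Rlt_dec c (lin w (fst vz)) then true else false else false) (list_prod L L)))%list).
  assert (HC : forall x, In x C -> S x /\ lin w x = c).
  { intros x Hx; unfold C in Hx; apply in_app_or in Hx; destruct Hx as [Hx|Hx].
    - apply filter_In in Hx; destruct Hx as [Hx Hc].
      destruct (Req_EM_T (lin w x) c); [|discriminate]; split; auto; apply HL; auto.
    - apply in_map_iff in Hx; destruct Hx as [[v z] [<- Hx]].
      apply filter_In in Hx; destruct Hx as [Hx Hc]; simpl in Hc.
      apply in_prod_iff in Hx; destruct Hx as [Hv Hz].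
      destruct (Rlt_dec (lin w z) c); [|discriminate].
      destruct (Rlt_dec c (lin w v)); [|discriminate].
      destruct (Hcross v z) as [H1 [H2 _]]; auto; apply HL; auto. }
  assert (HCon : forall v, In v L -> lin w v = c -> In v C).
  { intros v Hv Hc; unfold C; apply in_or_app; left; apply filter_In; split; auto.
    destruct (Req_EM_T (lin w v) c); auto. }
  assert (HCx : forall v z, In v L -> In z L -> lin w z < c < lin w v -> In (cross (v, z)) C).
  { intros v z Hv Hz Hc; unfold C; apply in_or_app; right; apply in_map, filter_In; split.
    - apply in_prod; auto.
    - simpl. destruct (Rlt_dec (lin w z) c); [|lra].
      destruct (Rlt_dec c (lin w v)); [auto|lra]. }
  assert (HCne : exists x, In x C /\ True).
  { destruct (hull_argmax L S w p HL Hp) as [v [Hv [_ Hvm]]].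
    destruct (hull_argmax L S (- fst w, - snd w) p HL Hp) as [z [Hz [_ Hzm]]].
    specialize (Hvm p Hp); specialize (Hzm p Hp).
    assert (Hzm' : lin w z <= c) by (unfold c, lin in *; simpl in Hzm; lra).
    fold c in Hvm.
    destruct (Req_dec (lin w v) c); [exists v; auto|].
    destruct (Req_dec (lin w z) c); [exists z; auto|].
    exists (cross (v, z)); split; auto; apply HCx; auto; lra. }
  destruct (list_argmin (lin u) (fun _ => True) C HCne) as [a [Ha [_ Hmin]]].
  destruct (HC a Ha) as [HaS Hac].
  destruct (classic (exists z, In z L /\ lin w z < c)) as [Hbelow|Hnone].
  - destruct (list_argmin (fun z => (lin u z - lin u a) / (c - lin w z)) (fun z => lin w z < c) L Hbelow)
      as [z [Hz [Hzc Hzmin]]].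
    exists a, ((lin u a - lin u z) / (c - lin w z)); split; [auto|split; [auto|]].
    set (rho := (lin u a - lin u z) / (c - lin w z)).
    assert (Hrho : rho * (c - lin w z) = lin u a - lin u z) by (unfold rho; field; lra).
    intros v Hv; rewrite Hac; destruct (Rtotal_order (lin w v) c) as [Hlt|[Heq|Hgt]].
    + specialize (Hzmin v Hv Hlt).
      replace ((lin u z - lin u a) / (c - lin w z)) with (- rho) in Hzmin by (unfold rho; field; lra).
      apply Rmult_le_compat_r with (r := c - lin w v) in Hzmin; [|lra].
      replace ((lin u v - lin u a) / (c - lin w v) * (c - lin w v)) with (lin u v - lin u a)
        in Hzmin by (field; lra).
      lra.
    + rewrite Heq. specialize (Hmin v (HCon v Hv Heq) I). lra.
    + specialize (Hmin _ (HCx v z Hv Hz (conj Hzc Hgt)) I).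
      destruct (Hcross v z) as [_ [_ Hx]]; [lra|apply HL; auto|apply HL; auto|].
      apply Rmult_le_reg_r with (c - lin w z); [lra|].
      replace (rho * (lin w v - c) * (c - lin w z)) with ((rho * (c - lin w z)) * (lin w v - c)) by ring.
      rewrite Hrho. nra.
  - assert (Hge : forall v, In v L -> c <= lin w v)
      by (intros v Hv; apply Rnot_lt_le; intros Hlt; apply Hnone; eauto).
    destruct (classic (exists z, In z L /\ c < lin w z)) as [Habove|Hnone'].
    + destruct (list_argmin (fun z => (lin u z - lin u a) / (lin w z - c)) (fun z => c < lin w z) L Habove)
        as [z [Hz [Hzc Hzmin]]].
      exists a, ((lin u z - lin u a) / (lin w z - c)); split; [auto|split; [auto|]].
      intros v Hv; rewrite Hac; destruct (Hge v Hv) as [Hgt|Heq].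
      * specialize (Hzmin v Hv Hgt).
        apply Rmult_le_compat_r with (r := lin w v - c) in Hzmin; [|lra].
        replace ((lin u v - lin u a) / (lin w v - c) * (lin w v - c)) with (lin u v - lin u a)
          in Hzmin by (field; lra).
        lra.
      * rewrite <- Heq. specialize (Hmin v (HCon v Hv (eq_sym Heq)) I). lra.
    + exists a, 0; split; [auto|split; [auto|]].
      intros v Hv.
      assert (Heq : lin w v = c).
      { destruct (Hge v Hv); auto; exfalso; apply Hnone'; eauto. }
      specialize (Hmin v (HCon v Hv Heq) I). lra.
Qed.

Lemma supporting_line_hull (L : list point) (S : point -> Prop) (u w a : point) (rho : R) :
  hull_of L S ->
  (forall v, In v L -> rho * (lin w v - lin w a) <= lin u v - lin u a) ->
  forall p, S p -> rho * (lin w p - lin w a) <= lin u p - lin u a.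
Proof.
  intros HL Hsup p Hp.
  assert (H : lin (rho * fst w - fst u, rho * snd w - snd u) p <= rho * lin w a - lin u a).
  { apply HL; auto; intros v Hv; specialize (Hsup v Hv); unfold lin in *; simpl; lra. }
  unfold lin in *; simpl in H; lra.
Qed.

(** * The upper bound *)

Definition domain (h : nat) (P P0 : point -> Prop) (H : nat -> point -> Prop)
  (L0 : list point) (L : nat -> list point) : Prop :=
  hull_of L0 P0 /\
  (forall i, (i < h)%nat -> hull_of (L i) (H i)) /\
  (forall i j, (i < h)%nat -> (j < h)%nat -> i <> j -> forall p, ~ (H i p /\ H j p)) /\
  (forall i, (i < h)%nat -> forall p, H i p -> interior P0 p) /\
  (forall p, P p <-> (P0 p /\ forall i, (i < h)%nat -> ~ interior (H i) p)).

Lemma hole_boundary_in_domain h P P0 H L0 L (i : nat) (x : point) :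
  domain h P P0 H L0 L -> (i < h)%nat -> H i x -> ~ interior (H i) x -> P x.
Proof.
  intros (_ & _ & Hdisj & Hin & HP) Hi Hx Hnx; apply HP; split.
  - apply interior_in; eauto.
  - intros j Hj Hint; destruct (Nat.eq_dec i j) as [->|Hij]; auto.
    apply (Hdisj i j Hi Hj Hij x); split; auto; apply interior_in; auto.
Qed.

Lemma outer_boundary_in_domain h P P0 H L0 L (x : point) :
  domain h P P0 H L0 L -> P0 x -> ~ interior P0 x -> P x.
Proof.
  intros (_ & _ & _ & Hin & HP) Hx Hnx; apply HP; split; auto.
  intros j Hj Hint; apply Hnx, (Hin j Hj), interior_in, Hint.
Qed.

Lemma horizontal_segment (p a x : point) :
  snd p = snd a -> fst p <= fst a -> segment p a x ->
  snd x = snd p /\ fst p <= fst x <= fst a.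
Proof. intros Hs Hf [l [Hl [Hx Hy]]]; rewrite Hx, Hy, <- Hs; split; [ring|nra]. Qed.

(** Among the holes whose interior meets the ray, [k] is one with leftmost entry point, so the ray
    is free up to [a]. The slope [rho] and the vertices above and below [a] are what
    [slide_around_hole] asks for. *)
Lemma horizontal_ray_hit h P P0 H L0 L (p : point) :
  domain h P P0 H L0 L -> P p ->
  (forall i, (i < h)%nat -> forall q, snd q = snd p -> fst p <= fst q -> ~ interior (H i) q) \/
  (exists k a rho, (k < h)%nat /\ H k a /\ snd a = snd p /\ fst p <= fst a /\
     (forall v, In v (L k) -> rho * (snd v - snd a) <= fst v - fst a) /\
     (exists v, In v (L k) /\ snd a < snd v) /\ (exists v, In v (L k) /\ snd v < snd a) /\
     (forall x, segment p a x -> P x)).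
Proof.
  intros Hdom HPp; pose proof Hdom as (HL0 & HL & Hdisj & Hin & HP).
  set (hit := fun i => (i < h)%nat /\ exists q, snd q = snd p /\ fst p <= fst q /\ interior (H i) q).
  assert (Hentry : forall i, exists ar : point * R, hit i ->
     H i (fst ar) /\ snd (fst ar) = snd p /\
     forall v, In v (L i) -> snd ar * (snd v - snd (fst ar)) <= fst v - fst (fst ar)).
  { intros i; destruct (classic (hit i)) as [[Hi [q [Hq1 [Hq2 Hq]]]]|Hn].
    - destruct (line_entry (L i) (H i) (1, 0) (0, 1) q (HL i Hi) (interior_in _ _ Hq))
        as [a [rho [Ha [Hay Hsup]]]].
      exists (a, rho); intros _; simpl; unfold lin in *; simpl in *; split; auto; split; [lra|].
      intros v Hv; specialize (Hsup v Hv); lra.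
    - exists (p, 0); tauto. }
  apply functional_choice in Hentry; destruct Hentry as [ar Har].
  destruct (classic (exists i, hit i)) as [[i0 Hi0]|Hnone].
  2: { left; intros i Hi q Hq1 Hq2 Hq; apply Hnone; exists i; split; eauto. }
  right.
  destruct (list_argmin (fun i => fst (fst (ar i))) hit (seq 0 h)) as [k [_ [Hk Hmin]]].
  { exists i0; split; auto; apply in_seq; destruct Hi0; lia. }
  destruct (Har k Hk) as [Ha [Hay Hsup]].
  pose proof Hk as [Hkh [q [Hq1 [Hq2 Hq]]]].
  set (a := fst (ar k)) in *; set (rho := snd (ar k)) in *.
  (* A point slightly to the left of [x] is still in the hole, hence not to the left of the
     supporting line at the entry point. *)
  assert (Hleft : forall i, hit i -> forall x, interior (H i) x -> snd x = snd p ->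
     fst (fst (ar i)) < fst x).
  { intros i Hi x [r [Hr Hx]] Hxy; destruct (Har i Hi) as [Ha' [Hay' Hsup']].
    assert (Hz : H i (fst x - r / 2, snd x)).
    { apply Hx; eapply Rle_lt_trans; [apply dist_le_l1|]; simpl.
      replace (fst x - (fst x - r / 2)) with (r / 2) by ring.
      replace (snd x - snd x) with 0 by ring.
      rewrite Rabs_R0, Rabs_pos_eq; lra. }
    pose proof (supporting_line_hull (L i) (H i) (1, 0) (0, 1) (fst (ar i)) (snd (ar i)) 
      (HL i (proj1 Hi))) as Hs.
    assert (Hs' := Hs ltac:(intros v Hv; specialize (Hsup' v Hv); unfold lin; simpl; lra) _ Hz).
    unfold lin in Hs'; simpl in Hs'.
    rewrite Hxy, Hay' in Hs'; lra. }
  (* Otherwise [p] would lie on the segment from [a] to the interior point [q], away from [a], and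
     so inside the hole. *)
  assert (Hpa : fst p <= fst a).
  { apply Rnot_lt_le; intros Hlt.
    apply (proj2 (proj1 (HP p) HPp) k Hkh).
    assert (Haq : fst a < fst q) by (unfold a; apply Hleft; auto).
    apply (interior_open_segment (H k) a q p ((fst p - fst a) / (fst q - fst a))); auto.
    - apply (HL k Hkh).
    - assert (0 < fst q - fst a) by lra. split.
      + apply Rdiv_lt_0_compat; lra.
      + apply Rmult_le_reg_r with (fst q - fst a); auto.
        unfold Rdiv; rewrite Rmult_assoc, Rinv_l; lra.
    - field; lra.
    - rewrite Hay, Hq1; field; lra. }
  exists k, a, rho; split; [auto|]; split; [auto|]; split; [auto|]; split; [auto|]; split; [auto|].
  split; [|split].
  - destruct (interior_vertex_above (L k) (H k) (0, 1) q) as [v [Hv Hlt]]; auto.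
    { simpl; right; lra. }
    exists v; split; auto; unfold lin in Hlt; simpl in Hlt; lra.
  - destruct (interior_vertex_above (L k) (H k) (0, -1) q) as [v [Hv Hlt]]; auto.
    { simpl; right; lra. }
    exists v; split; auto; unfold lin in Hlt; simpl in Hlt; lra.
  - intros x Hx. destruct (horizontal_segment p a x (eq_sym Hay) Hpa Hx) as [Hxy Hxx].
    apply HP; split.
    + apply (proj1 (proj2 HL0) p a x); auto; [apply HP; auto|].
      apply interior_in, (Hin k Hkh); auto.
    + intros i Hi Hint.
      assert (Hhit : hit i) by (split; auto; exists x; repeat split; auto; lra).
      pose proof (Hleft i Hhit x Hint Hxy).
      assert (In i (seq 0 h)) by (apply in_seq; lia).
      specialize (Hmin i H1 Hhit). fold a in Hmin. lra.
Qed.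

(* [B0] and [B2] minimise [x + (tau - d) y] and [x + (tau + d) y]. A steep climb
   ([Delta y > Delta X / d] for [X = x + tau y]) from [a] forces the slope [rho] into
   [-tau, -tau + d), so that [a] lies on the boundary between [B0] and [B2]. *)
Lemma steep_climb_bound (d tau rho ax ay Tx Ty B0x B0y B2x B2y : R) :
  0 < d -> 0 <= rho + tau -> ay <= Ty ->
  rho * (Ty - ay) <= Tx - ax -> rho * (B0y - ay) <= B0x - ax -> rho * (B2y - ay) <= B2x - ax ->
  B0x + (tau - d) * B0y <= Tx + (tau - d) * Ty ->
  B0x + (tau - d) * B0y <= B2x + (tau - d) * B2y ->
  B2x + (tau + d) * B2y <= ax + (tau + d) * ay ->
  B2x + (tau + d) * B2y <= B0x + (tau + d) * B0y ->
  d * (Ty - ay) <= (Tx + tau * Ty) - (ax + tau * ay) + d * (B0y - B2y).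
Proof.
  intros Hd Hrt HTy HT HB0 HB2 Hm1 Hm2 Hm3 Hm4.
  assert (He : 0 <= d * (B0y - B2y)) by nra.
  destruct (Rle_lt_dec d (rho + tau)) as [Hle|Hlt]; [nra|].
  assert (Hay : B2y <= ay).
  { apply Rnot_lt_le; intros Hc. assert (0 < (rho + tau + d) * (B2y - ay)) by (apply Rmult_lt_0_compat; lra). lra. }
  assert (Hex : d * (Ty - ay) - ((Tx + tau * Ty) - (ax + tau * ay)) <= (d - rho - tau) * (B0y - ay)) by lra.
  destruct (Rle_lt_dec (B0y - ay) 0) as [Hc|Hc].
  - assert ((d - rho - tau) * (B0y - ay) <= 0) by nra. lra.
  - assert ((d - rho - tau) * (B0y - ay) <= d * (B0y - ay)) by (apply Rmult_le_compat_r; lra).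
    assert (d * (B0y - ay) <= d * (B0y - B2y)) by (apply Rmult_le_compat_l; lra). lra.
Qed.

(** Climbing an edge parallel to the level lines of [X] leaves [X] constant. Breaking ties by height
    makes every slide a strict increase, so no exit is used twice. *)
Definition lex_lt (tau : R) (p q : point) : Prop :=
  lin (1, tau) p < lin (1, tau) q \/ (lin (1, tau) p = lin (1, tau) q /\ snd p < snd q).

(** As [x = X - tau * y], a change of [x] costs at most that of [X] plus twice that of [y]; adding
    the change of [y] itself gives the factor 3. *)
Lemma shear_dist (tau : R) (p q : point) : 0 <= tau <= 2 ->
  dist p q <= 1 * Rabs (lin (1, tau) p - lin (1, tau) q) + 3 * Rabs (snd p - snd q).
Proof.
  intros Htau; eapply Rle_trans; [apply dist_le_l1|].
  unfold lin; simpl.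
  replace (fst p - fst q) with ((1 * fst p + tau * snd p - (1 * fst q + tau * snd q)) + - (tau * (snd p - snd q)))
    by ring.
  set (D := 1 * fst p + tau * snd p - (1 * fst q + tau * snd q)).
  pose proof (Rabs_triang D (- (tau * (snd p - snd q)))) as Ht.
  rewrite Rabs_Ropp, Rabs_mult, (Rabs_pos_eq tau) in Ht by lra.
  pose proof (Rabs_pos (snd p - snd q)); nra.
Qed.

(** In the coordinates [X] and [y] the supporting line at [a] has slope [rho + tau], whose sign
    tells whether [X] grows upwards, to [Top], or downwards, to [Bot]. By [steep_climb_bound] with
    [d = 1 / m], the height covered is at most [m] times the gain in [X] plus the height from [B2]
    to [B0]. *)
Lemma slide_around_hole (L : list point) (S : point -> Prop) (Top Bot B0 B2 a : point) (m : nat)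
  (tau rho : R) :
  hull_of L S -> (1 <= m)%nat -> 0 <= tau <= 2 -> S a ->
  In Top L -> (forall v, In v L -> snd v <= snd Top) ->
  In Bot L -> (forall v, In v L -> snd Bot <= snd v) ->
  In B0 L -> (forall p, S p -> lin (1, tau - / INR m) B0 <= lin (1, tau - / INR m) p) ->
  In B2 L -> (forall p, S p -> lin (1, tau + / INR m) B2 <= lin (1, tau + / INR m) p) ->
  (forall v, In v L -> rho * (snd v - snd a) <= fst v - fst a) ->
  (exists v, In v L /\ snd a < snd v) -> (exists v, In v L /\ snd v < snd a) ->
  exists T, (T = Top \/ T = Bot) /\ lex_lt tau a T /\ lin (1, tau) a <= lin (1, tau) T /\
    reach (fun x => S x /\ ~ interior S x) a T
      ((1 + 3 * INR m) * (lin (1, tau) T - lin (1, tau) a) + 3 * (snd B0 - snd B2)).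
Proof.
  intros HL Hm Htau Ha HTop HTm HBot HBm HB0 HB0m HB2 HB2m Hsup [v1 [Hv1 Hv1a]] [v2 [Hv2 Hv2a]].
  assert (HmR : 0 < INR m) by (apply lt_0_INR; lia).
  set (d := / INR m) in *.
  assert (Hd : 0 < d) by (apply Rinv_0_lt_compat; auto).
  assert (Hmd : INR m * d = 1) by (unfold d; field; lra).
  assert (HS : forall v, In v L -> S v) by apply HL.
  assert (Hdiv : forall x y e, d * x <= y + d * e -> x <= INR m * y + e).
  { intros x y e Hx. apply Rmult_le_compat_l with (r := INR m) in Hx; [|lra].
    replace (INR m * (d * x)) with x in Hx by (rewrite <- Rmult_assoc, Hmd; ring).
    replace (INR m * (y + d * e)) with (INR m * y + INR m * d * e) in Hx by ring.
    rewrite Hmd in Hx; lra. }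
  pose proof (HTm _ Hv1); pose proof (HBm _ Hv2).
  pose proof (HB0m _ (HS _ HTop)); pose proof (HB0m _ (HS _ HBot)).
  pose proof (HB0m _ Ha); pose proof (HB0m _ (HS _ HB2)).
  pose proof (HB2m _ (HS _ HTop)); pose proof (HB2m _ (HS _ HBot)).
  pose proof (HB2m _ Ha); pose proof (HB2m _ (HS _ HB0)).
  pose proof (Hsup _ HTop) as HsT; pose proof (Hsup _ HBot) as HsB.
  pose proof (Hsup _ HB0); pose proof (Hsup _ HB2).
  unfold lin in * |- ; simpl in * |-.
  destruct (Rle_lt_dec 0 (rho + tau)) as [Hup|Hdown].
  - exists Top.
    assert (HX : lin (1, tau) a <= lin (1, tau) Top) by (unfold lin; simpl; nra).
    split; [auto|]; split; [|split; [auto|]].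
    { destruct HX as [HX|HX]; [left; auto|right; split; auto; lra]. }
    eapply reach_le.
    + apply (boundary_chain L S (1, tau) (0, 1) 1 3 Top) with (rho := rho + tau); auto.
      * simpl; lra.
      * intros p q. pose proof (shear_dist tau p q Htau) as Hsh.
        replace (lin (0, 1) p - lin (0, 1) q) with (snd p - snd q) by (unfold lin; simpl; ring); auto.
      * intros v Hv; unfold lin; simpl; specialize (HTm v Hv); lra.
      * intros v Hv; specialize (Hsup v Hv); unfold lin; simpl; lra.
    + assert (Hs : snd Top - snd a <= INR m * (lin (1, tau) Top - lin (1, tau) a) + (snd B0 - snd B2)).
      { apply Hdiv; unfold lin; simpl.
        pose proof (steep_climb_bound d tau rho (fst a) (snd a) (fst Top) (snd Top) (fst B0) (snd B0)
          (fst B2) (snd B2) Hd Hup) as Hst.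
        lra. }
      replace (lin (0, 1) Top - lin (0, 1) a) with (snd Top - snd a) by (unfold lin; simpl; ring).
      lra.
  - exists Bot.
    assert (HX : lin (1, tau) a < lin (1, tau) Bot) by (unfold lin; simpl; nra).
    split; [auto|]; split; [left; auto|split; [lra|]].
    eapply reach_le.
    + apply (boundary_chain L S (1, tau) (0, -1) 1 3 Bot) with (rho := - (rho + tau)); auto.
      * simpl; lra.
      * intros p q. pose proof (shear_dist tau p q Htau) as Hsh.
        replace (lin (0, -1) p - lin (0, -1) q) with (- (snd p - snd q)) by (unfold lin; simpl; ring).
        rewrite Rabs_Ropp; auto.
      * intros v Hv; unfold lin; simpl; specialize (HBm v Hv); lra.
      * lra.
      * intros v Hv; specialize (Hsup v Hv); unfold lin; simpl; lra.
    + assert (Hs : snd a - snd Bot <= INR m * (lin (1, tau) Bot - lin (1, tau) a) + (snd B0 - snd B2)).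
      { apply Hdiv; unfold lin; simpl.
        (* The descent is the climb reflected in the x-axis: [tau], [rho] and heights change sign,
           and [B0] and [B2] swap roles. *)
        pose proof (steep_climb_bound d (- tau) (- rho) (fst a) (- snd a) (fst Bot) (- snd Bot)
          (fst B2) (- snd B2) (fst B0) (- snd B0) Hd) as Hst.
        lra. }
      replace (lin (0, -1) Bot - lin (0, -1) a) with (snd a - snd Bot) by (unfold lin; simpl; ring).
      lra.
Qed.

(** The ray leaves [P0] at [b]. From there [boundary_chain] runs with the coordinates exchanged: it
    maximises [x], while [y] or [-y] increases according to the sign of [rho], and the initial slope
    is [1 / |rho|]. Both coordinates change by at most [D]. *)
Lemma reach_rightmost h P P0 H L0 L (D : R) (Rt p : point) :
  domain h P P0 H L0 L -> (forall p q, P p -> P q -> dist p q <= D) ->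
  In Rt L0 -> (forall v, In v L0 -> fst v <= fst Rt) -> P p ->
  (forall i, (i < h)%nat -> forall q, snd q = snd p -> fst p <= fst q -> ~ interior (H i) q) ->
  exists b, P b /\ snd b = snd p /\ fst p <= fst b /\
    reach P p Rt (fst b - fst p + 2 * D).
Proof.
  intros Hdom HD HRt HRm HPp Hfree; pose proof Hdom as (HL0 & HL & Hdisj & Hin & HP).
  assert (Hp0 : P0 p) by (apply HP; auto).
  destruct (line_entry L0 P0 (-1, 0) (0, 1) p HL0 Hp0) as [b [rho [Hb [Hby Hsup]]]].
  pose proof (supporting_line_hull _ _ _ _ _ _ HL0 Hsup) as HsupS.
  pose proof (HsupS p Hp0) as Hpb.
  assert (Hby' : snd b = snd p) by (unfold lin in Hby; simpl in Hby; lra).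
  assert (Hpb' : fst p <= fst b) by (unfold lin in Hpb; simpl in Hpb; rewrite Hby' in Hpb; lra).
  assert (HbP : P b).
  { apply (outer_boundary_in_domain _ _ _ _ _ _ b Hdom Hb).
    apply (max_not_interior P0 (1, rho)); [left; simpl; lra|].
    intros q Hq; specialize (HsupS q Hq); unfold lin in *; simpl in *; lra. }
  assert (HRS : P0 Rt) by (apply HL0; auto).
  assert (HRm' : forall q, P0 q -> lin (1, 0) q <= lin (1, 0) Rt).
  { apply HL0; intros v Hv; specialize (HRm v Hv); unfold lin; simpl; lra. }
  assert (HRP : P Rt).
  { apply (outer_boundary_in_domain _ _ _ _ _ _ Rt Hdom HRS).
    apply (max_not_interior P0 (1, 0)); auto; left; simpl; lra. }
  pose proof (HD b Rt HbP HRP) as HDb.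
  pose proof (Rle_trans _ _ _ (abs_fst_le_dist b Rt) HDb) as H1.
  pose proof (Rle_trans _ _ _ (abs_snd_le_dist b Rt) HDb) as H2.
  apply Rabs_le_between in H1; apply Rabs_le_between in H2.
  exists b; split; [auto|]; split; [auto|]; split; [auto|].
  apply (reach_trans P p b Rt).
  { eapply reach_le; [apply reach_segment|].
    - intros x Hx; destruct (horizontal_segment p b x (eq_sym Hby') Hpb' Hx).
      apply HP; split; [apply (proj1 (proj2 HL0) p b x); auto|].
      intros i Hi; apply Hfree; auto; lra.
    - eapply Rle_trans; [apply dist_le_l1|].
      rewrite Hby', Rminus_diag, Rabs_R0, Rabs_minus_sym, Rabs_pos_eq; lra. }
  apply (reach_subset (fun x => P0 x /\ ~ interior P0 x)).
  { intros x [Hx Hnx]; apply (outer_boundary_in_domain _ _ _ _ _ _ x Hdom); auto. }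
  assert (Hsup' : forall v, In v L0 -> rho * (snd v - snd b) <= fst b - fst v).
  { intros v Hv; specialize (Hsup v Hv); unfold lin in Hsup; simpl in Hsup; lra. }
  destruct (Rtotal_order rho 0) as [Hneg|[Hz|Hpos]].
  - eapply reach_le.
    + apply (boundary_chain L0 P0 (0, 1) (1, 0) 1 1 Rt) with (rho := - / rho); auto.
      * simpl; lra.
      * intros x y. pose proof (dist_le_l1 x y).
        replace (lin (1, 0) x - lin (1, 0) y) with (fst x - fst y) by (unfold lin; simpl; ring).
        replace (lin (0, 1) x - lin (0, 1) y) with (snd x - snd y) by (unfold lin; simpl; ring).
        lra.
      * intros v Hv; apply HRm'; apply HL0; auto.
      * assert (/ rho < 0) by (apply Rinv_lt_0_compat; auto); lra.
      * intros v Hv; specialize (Hsup' v Hv); unfold lin; simpl.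
        apply Rmult_le_reg_l with (- rho); [lra|].
        replace (- rho * (- / rho * (1 * fst v + 0 * snd v - (1 * fst b + 0 * snd b))))
          with (fst v - fst b) by (field; lra).
        lra.
    + unfold lin; simpl; lra.
  (* A vertical supporting line at [b] puts [b] on the rightmost face. *)
  - subst rho.
    assert (Hx : fst b = fst Rt).
    { specialize (Hsup' Rt HRt). specialize (HRm' b Hb). unfold lin in HRm'; simpl in HRm'. lra. }
    eapply reach_le; [apply reach_segment|lra].
    apply (segment_in_face P0 (1, 0)); auto.
    + apply HL0.
    + left; simpl; lra.
    + unfold lin; simpl; lra.
    + intros q Hq; specialize (HRm' q Hq); unfold lin in *; simpl in *; lra.
  - eapply reach_le.
    + apply (boundary_chain L0 P0 (0, -1) (1, 0) 1 1 Rt) with (rho := / rho); auto.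
      * simpl; lra.
      * intros x y. pose proof (dist_le_l1 x y).
        replace (lin (1, 0) x - lin (1, 0) y) with (fst x - fst y) by (unfold lin; simpl; ring).
        replace (lin (0, -1) x - lin (0, -1) y) with (- (snd x - snd y)) by (unfold lin; simpl; ring).
        rewrite Rabs_Ropp; lra.
      * intros v Hv; apply HRm'; apply HL0; auto.
      * assert (0 < / rho) by (apply Rinv_0_lt_compat; auto); lra.
      * intros v Hv; specialize (Hsup' v Hv); unfold lin; simpl.
        apply Rmult_le_reg_l with rho; [lra|].
        replace (rho * (/ rho * (1 * fst v + 0 * snd v - (1 * fst b + 0 * snd b))))
          with (fst v - fst b) by (field; lra).
        lra.
    + unfold lin; simpl; lra.
Qed.

(** * A potential for the walk: the exits still ahead *)

Definition toll (tau : R) (c : R) (p T : point) : R :=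
  if excluded_middle_informative (lex_lt tau p T) then c else 0.

(* The total weight of the exits (top and bottom vertices of the holes) that a path
   increasing in the order [lex_lt] may still use. *)
Definition tolls (tau : R) (Top Bot : nat -> point) (c : nat -> R) (h : nat) (p : point) : R :=
  fsum (fun i => toll tau (c i) p (Top i) + toll tau (c i) p (Bot i)) h.

Lemma lex_lt_trans (tau : R) (p q r : point) : lex_lt tau p q -> lex_lt tau q r -> lex_lt tau p r.
Proof. unfold lex_lt; intros; lra. Qed.

Lemma toll_antitone (tau c : R) (p q T : point) :
  0 <= c -> lex_lt tau p q -> toll tau c q T <= toll tau c p T.
Proof.
  intros Hc Hpq; unfold toll.
  destruct (excluded_middle_informative (lex_lt tau q T)) as [H|H];
  destruct (excluded_middle_informative (lex_lt tau p T)) as [H'|H']; try lra.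
  exfalso; apply H'; eapply lex_lt_trans; eauto.
Qed.

Lemma toll_bounds (tau c : R) (p T : point) : 0 <= c -> 0 <= toll tau c p T <= c.
Proof. intros; unfold toll; destruct (excluded_middle_informative _); lra. Qed.

(** By transitivity no exit comes to be ahead again, while [T], ahead of [p], is not ahead of
    itself; so a weight [c k] is lost. *)
Lemma tolls_step (tau : R) (Top Bot : nat -> point) (c : nat -> R) (h k : nat) (p T : point) :
  (forall i, (i < h)%nat -> 0 <= c i) -> (k < h)%nat -> (T = Top k \/ T = Bot k) -> lex_lt tau p T ->
  tolls tau Top Bot c h T + c k <= tolls tau Top Bot c h p.
Proof.
  intros Hc Hk HT Hlt; apply (fsum_gain _ _ h k); auto.
  - intros i Hi; specialize (Hc i Hi).
    pose proof (toll_antitone tau (c i) p T (Top i) Hc Hlt).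
    pose proof (toll_antitone tau (c i) p T (Bot i) Hc Hlt). lra.
  - specialize (Hc k Hk).
    pose proof (toll_antitone tau (c k) p T (Top k) Hc Hlt).
    pose proof (toll_antitone tau (c k) p T (Bot k) Hc Hlt).
    assert (HTT : toll tau (c k) T T = 0).
    { unfold toll; destruct (excluded_middle_informative _) as [Hl|]; auto.
      unfold lex_lt in Hl; lra. }
    assert (HpT : toll tau (c k) p T = c k).
    { unfold toll; destruct (excluded_middle_informative _) as [Hl|]; tauto. }
    destruct HT as [<-|<-]; lra.
Qed.

Lemma tolls_bounds (tau : R) (Top Bot : nat -> point) (c : nat -> R) (h : nat) (p : point) :
  (forall i, (i < h)%nat -> 0 <= c i) -> 0 <= tolls tau Top Bot c h p <= 2 * fsum c h.
Proof.
  intros Hc; split.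
  - replace 0 with (fsum (fun _ => 0) h) by (rewrite fsum_const; ring).
    apply fsum_le; intros i Hi; specialize (Hc i Hi).
    pose proof (toll_bounds tau (c i) p (Top i) Hc); pose proof (toll_bounds tau (c i) p (Bot i) Hc); lra.
  - rewrite <- fsum_scal; apply fsum_le; intros i Hi; specialize (Hc i Hi).
    pose proof (toll_bounds tau (c i) p (Top i) Hc); pose proof (toll_bounds tau (c i) p (Bot i) Hc); lra.
Qed.

(** The bound is a potential of [p] that drops at each slide by at least the length walked: the gain
    in [X] pays with factor [1 + 3 * INR m], the exit reached with 3 times its weight. The final
    [2 * D] is for the outer boundary. *)
Lemma reach_rightmost_tolls h P P0 H L0 L (D : R) (Rt : point) (m : nat) (tau M : R)
  (Top Bot B0 B2 : nat -> point) :
  domain h P P0 H L0 L -> (forall p q, P p -> P q -> dist p q <= D) ->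
  In Rt L0 -> (forall v, In v L0 -> fst v <= fst Rt) ->
  (1 <= m)%nat -> 0 <= tau <= 2 ->
  (forall q, P q -> lin (1, tau) q <= M) ->
  (forall i, (i < h)%nat ->
    In (Top i) (L i) /\ (forall v, In v (L i) -> snd v <= snd (Top i)) /\
    In (Bot i) (L i) /\ (forall v, In v (L i) -> snd (Bot i) <= snd v) /\
    In (B0 i) (L i) /\ (forall p, H i p -> lin (1, tau - / INR m) (B0 i) <= lin (1, tau - / INR m) p) /\
    In (B2 i) (L i) /\ (forall p, H i p -> lin (1, tau + / INR m) (B2 i) <= lin (1, tau + / INR m) p) /\
    0 <= snd (B0 i) - snd (B2 i)) ->
  forall p, P p -> reach P p Rt ((1 + 3 * INR m) * (M - lin (1, tau) p) +
     3 * tolls tau Top Bot (fun i => snd (B0 i) - snd (B2 i)) h p + 2 * D).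
Proof.
  intros Hdom HD HRt HRm Hm Htau HM Hdata; pose proof Hdom as (HL0 & HL & Hdisj & Hin & HP).
  set (e := fun i => snd (B0 i) - snd (B2 i)).
  assert (He : forall i, (i < h)%nat -> 0 <= e i) by (intros i Hi; apply (Hdata i Hi)).
  assert (HmR : 0 < INR m) by (apply lt_0_INR; lia).
  (* Unit weights count the exits ahead and so bound the number of slides left. *)
  assert (Hmain : forall N p, P p -> tolls tau Top Bot (fun _ => 1) h p <= INR N ->
    reach P p Rt ((1 + 3 * INR m) * (M - lin (1, tau) p) + 3 * tolls tau Top Bot e h p + 2 * D)).
  { induction N as [|N IH]; intros p Hp HN.
    all: pose proof (tolls_bounds tau Top Bot e h p He) as He0.
    all: destruct (horizontal_ray_hit h P P0 H L0 L p Hdom Hp)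
       as [Hfree|(k & a & rho & Hk & Ha & Hay & Hpa & Hsup & Hab & Hbe & Hseg)].
    1, 3: destruct (reach_rightmost h P P0 H L0 L D Rt p Hdom HD HRt HRm Hp Hfree) as (b & Hb & Hby & Hpb & Hr).
    1, 2: eapply reach_le; [exact Hr|]; specialize (HM b Hb); unfold lin in *; simpl in *; rewrite Hby in HM; nra.
    all: destruct (Hdata k Hk) as (HT1 & HT2 & HT3 & HT4 & HT5 & HT6 & HT7 & HT8 & _).
    all: destruct (slide_around_hole (L k) (H k) (Top k) (Bot k) (B0 k) (B2 k) a m tau rho)
      as [T [HT [Hlex [HX Hr]]]]; auto.
    all: assert (HpX : lin (1, tau) p <= lin (1, tau) a /\ lin (1, tau) a - lin (1, tau) p = fst a - fst p)
      by (unfold lin; simpl; rewrite Hay; lra).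
    all: assert (Hlex' : lex_lt tau p T) by (unfold lex_lt in *; rewrite Hay in Hlex; lra).
    all: pose proof (tolls_step tau Top Bot (fun _ => 1) h k p T ltac:(intros; lra) Hk HT Hlex') as Hst; simpl in Hst.
    - pose proof (tolls_bounds tau Top Bot (fun _ => 1) h T ltac:(intros; lra)); simpl in HN; lra.
    - rewrite S_INR in HN.
      assert (HTP : P T).
      { assert (HTL : In T (L k)) by (destruct HT as [->| ->]; auto).
        apply (hole_boundary_in_domain h P P0 H L0 L k); auto; [apply (HL k Hk); auto|].
        destruct HT as [-> | ->].
        - apply (max_not_interior (H k) (0, 1)); [right; simpl; lra|].
          apply (HL k Hk); intros v Hv; specialize (HT2 v Hv); unfold lin; simpl; lra.
        - apply (max_not_interior (H k) (0, -1)); [right; simpl; lra|].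
          apply (HL k Hk); intros v Hv; specialize (HT4 v Hv); unfold lin; simpl; lra. }
      pose proof (tolls_step tau Top Bot e h k p T He Hk HT Hlex') as Hste.
      eapply reach_le.
      + eapply (reach_trans P p a Rt); [apply reach_segment, Hseg|].
        eapply (reach_trans P a T Rt).
        * eapply reach_subset; [|exact Hr].
          intros x [Hx Hnx]; apply (hole_boundary_in_domain h P P0 H L0 L k); auto.
        * apply IH; auto; lra.
      + assert (Hd : dist p a <= fst a - fst p).
        { eapply Rle_trans; [apply dist_le_l1|].
          rewrite Hay, Rminus_diag, Rabs_R0, Rabs_minus_sym, Rabs_pos_eq; lra. }
        unfold e in Hste at 2. nra. }
  intros p Hp; destruct (INR_unbounded (tolls tau Top Bot (fun _ => 1) h p)) as [N HN].
  apply (Hmain N p Hp); lra.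
Qed.

(** * Diameters and the choice of the shear *)

Lemma in_C_domain (h : nat) (P : point -> Prop) :
  in_C h P -> exists P0 H L0 L, domain h P P0 H L0 L /\ (exists p, interior P0 p) /\
    forall i, (i < h)%nat -> exists p, H i p.
Proof.
  intros (P0 & H & Hc0 & Hc & Hdisj & Hin & HP).
  destruct (convex_polygon_hull P0 Hc0) as [L0 HL0].
  assert (HL : forall i, exists L, (i < h)%nat -> hull_of L (H i)).
  { intros i; destruct (classic (i < h)%nat) as [Hi|Hi]; [|exists nil; tauto].
    destruct (convex_polygon_hull (H i) (Hc i Hi)) as [L HL]; exists L; auto. }
  apply functional_choice in HL; destruct HL as [L HL].
  exists P0, H, L0, L; split; [|split].
  - exact (conj HL0 (conj HL (conj Hdisj (conj Hin HP)))).
  - apply Hc0.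
  - intros i Hi; destruct (Hc i Hi) as [_ [p Hp]]; exists p; apply interior_in; auto.
Qed.

Lemma diam2_finite (P : point -> Prop) (M : R) (p q : point) :
  (forall p q, P p -> P q -> dist p q <= M) -> P p -> P q ->
  exists D, diam2 P = Finite D /\ D <= M /\ (forall p q, P p -> P q -> dist p q <= D).
Proof.
  intros HM Hp Hq; unfold diam2.
  set (E := fun r => exists s t, P s /\ P t /\ r = dist s t).
  destruct (Lub_Rbar_correct E) as [Hub Hleast].
  assert (Hle : Rbar_le (Lub_Rbar E) (Finite M)).
  { apply Hleast; intros x (s & t & Hs & Ht & ->); apply HM; auto. }
  assert (Hge : forall s t, P s -> P t -> Rbar_le (Finite (dist s t)) (Lub_Rbar E)).
  { intros s t Hs Ht; apply Hub; exists s, t; auto. }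
  destruct (Lub_Rbar E) as [D| |]; simpl in *.
  - exists D; auto.
  - destruct Hle.
  - destruct (Hge p q Hp Hq).
Qed.

(** Extreme vertices of [P0] in the four axis directions belong to [P]. They bound all distances,
    and the left and right ones lie strictly on either side of an interior point. *)
Lemma diam2_positive (h : nat) (P : point -> Prop) :
  in_C h P -> exists D, diam2 P = Finite D /\ 0 < D /\ (forall p q, P p -> P q -> dist p q <= D).
Proof.
  intros HC; destruct (in_C_domain h P HC) as (P0 & H & L0 & L & Hdom & [c Hc] & _).
  pose proof Hdom as (HL0 & _ & _ & _ & HP).
  pose proof (interior_in _ _ Hc) as Hc0.
  assert (Hext : forall u, fst u <> 0 \/ snd u <> 0 ->
    exists T, P T /\ lin u c < lin u T /\ forall q, P0 q -> lin u q <= lin u T).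
  { intros u Hu; destruct (hull_argmax L0 P0 u c HL0 Hc0) as [T [HT [_ HTm]]].
    exists T; split; [|split; auto].
    - apply (outer_boundary_in_domain _ _ _ _ _ _ T Hdom); [apply HL0; auto|].
      apply (max_not_interior P0 u T Hu HTm).
    - apply Rnot_le_lt; intros Hle; apply (max_not_interior P0 u c Hu); auto.
      intros q Hq; specialize (HTm q Hq); lra. }
  destruct (Hext (1, 0)) as [R1 [HR1 [HR2 HR3]]]; [left; simpl; lra|].
  destruct (Hext (-1, 0)) as [L1 [HL1 [HL2 HL3]]]; [left; simpl; lra|].
  destruct (Hext (0, 1)) as [T1 [HT1 [HT2 HT3]]]; [right; simpl; lra|].
  destruct (Hext (0, -1)) as [B1 [HB1 [HB2 HB3]]]; [right; simpl; lra|].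
  destruct (diam2_finite P ((fst R1 - fst L1) + (snd T1 - snd B1)) R1 L1) as [D [HD [_ HDm]]]; auto.
  { intros p q Hp Hq; apply HP in Hp; apply HP in Hq; destruct Hp as [Hp _], Hq as [Hq _].
    eapply Rle_trans; [apply dist_le_l1|].
    pose proof (HR3 p Hp); pose proof (HR3 q Hq); pose proof (HL3 p Hp); pose proof (HL3 q Hq).
    pose proof (HT3 p Hp); pose proof (HT3 q Hq); pose proof (HB3 p Hp); pose proof (HB3 q Hq).
    unfold lin in *; simpl in *.
    apply Rplus_le_compat; apply Rabs_le_between; lra. }
  exists D; split; [auto|]; split; [|auto].
  eapply Rlt_le_trans; [|apply (HDm R1 L1); auto].
  eapply Rlt_le_trans; [|apply abs_fst_le_dist].
  unfold lin in *; simpl in *; rewrite Rabs_pos_eq; lra.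
Qed.

(** The stride is two because the slide with shear [(j+1)/m] compares the minimisers for [j/m] and
    [(j+2)/m]. *)
Lemma fsum_telescope2 (y : nat -> R) (m : nat) :
  fsum (fun j => y j - y (S (S j))) m = y 0%nat + y 1%nat - y m - y (S m).
Proof. induction m as [|m IH]; simpl; [ring|rewrite IH; ring]. Qed.

Lemma ceil_sqrt (h : nat) :
  (1 <= h)%nat -> exists m, (1 <= m)%nat /\ sqrt (INR h) <= INR m <= 2 * sqrt (INR h).
Proof.
  intros Hh.
  assert (H1 : 1 <= sqrt (INR h)).
  { rewrite <- sqrt_1; apply sqrt_le_1_alt; apply (le_INR 1); auto. }
  destruct (archimed (sqrt (INR h))) as [Ha Hb].
  assert (Hz : (1 <= up (sqrt (INR h)))%Z) by (apply le_IZR; lra).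
  exists (Z.to_nat (up (sqrt (INR h)))).
  rewrite (INR_IZR_INZ (Z.to_nat _)), Z2Nat.id by lia; split; [lia|lra].
Qed.

Lemma domain_reach (h : nat) (P : point -> Prop) (D : R) :
  (1 <= h)%nat -> in_C h P -> (forall p q, P p -> P q -> dist p q <= D) ->
  forall s t, P s -> P t -> reach P s t (70 * sqrt (INR h) * D).
Proof.
  intros Hh HC HD.
  destruct (in_C_domain h P HC) as (P0 & H & L0 & L & Hdom & [c Hc] & Hne).
  pose proof Hdom as (HL0 & HL & _ & _ & HP).
  pose proof (interior_in _ _ Hc) as Hc0.
  destruct (hull_argmax L0 P0 (1, 0) c HL0 Hc0) as [Rt [HRt [HRm _]]].
  assert (HRm' : forall v, In v L0 -> fst v <= fst Rt)
    by (intros v Hv; specialize (HRm v Hv); unfold lin in HRm; simpl in HRm; lra).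
  assert (Hext : forall u, fst u <> 0 \/ snd u <> 0 -> exists T : nat -> point, forall i, (i < h)%nat ->
     In (T i) (L i) /\ P (T i) /\ forall q, H i q -> lin u q <= lin u (T i)).
  { intros u Hu; apply (functional_choice (fun i T => (i < h)%nat ->
     In T (L i) /\ P T /\ forall q, H i q -> lin u q <= lin u T)); intros i.
    destruct (classic (i < h)%nat) as [Hi|Hi]; [|exists c; tauto].
    destruct (Hne i Hi) as [p Hp].
    destruct (hull_argmax (L i) (H i) u p (HL i Hi) Hp) as [T [HT [_ HTm]]].
    exists T; intros _; split; [auto|split; [|auto]].
    apply (hole_boundary_in_domain h P P0 H L0 L i); auto; [apply (HL i Hi); auto|].
    apply (max_not_interior (H i) u T Hu HTm). }
  destruct (ceil_sqrt h Hh) as [m [Hm [Hm1 Hm2]]].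
  assert (HmR : 0 < INR m) by (apply lt_0_INR; lia).
  destruct (Hext (0, 1)) as [Top HTop]; [right; simpl; lra|].
  destruct (Hext (0, -1)) as [Bot HBot]; [right; simpl; lra|].
  assert (HB : exists B : nat -> nat -> point, forall j i, (i < h)%nat ->
     In (B j i) (L i) /\ P (B j i) /\
     forall q, H i q -> lin (1, INR j / INR m) (B j i) <= lin (1, INR j / INR m) q).
  { apply (functional_choice (fun j (B : nat -> point) => forall i, (i < h)%nat ->
     In (B i) (L i) /\ P (B i) /\
     forall q, H i q -> lin (1, INR j / INR m) (B i) <= lin (1, INR j / INR m) q)); intros j.
    destruct (Hext (-1, - (INR j / INR m))) as [B HB]; [left; simpl; lra|].
    exists B; intros i Hi; destruct (HB i Hi) as [H1 [H2 H3]]; split; [auto|split; [auto|]].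
    intros q Hq; specialize (H3 q Hq); unfold lin in *; simpl in *; lra. }
  destruct HB as [B HB].
  set (e := fun j i => snd (B j i) - snd (B (S (S j)) i)).
  assert (HBS : forall j i, (i < h)%nat -> H i (B j i)) by (intros j i Hi; apply (HL i Hi), HB; auto).
  (* Adding the two minimality conditions shows that the larger shear has the lower minimiser. *)
  assert (He : forall j i, (i < h)%nat -> 0 <= e j i).
  { intros j i Hi; unfold e.
    destruct (HB j i Hi) as [_ [_ H1]], (HB (S (S j)) i Hi) as [_ [_ H2]].
    specialize (H1 _ (HBS (S (S j)) i Hi)); specialize (H2 _ (HBS j i Hi)).
    unfold lin in *; cbn [fst snd] in *; rewrite !S_INR in H2.
    replace ((INR j + 1 + 1) / INR m) with (INR j / INR m + 2 * / INR m) in H2 by (field; lra).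
    assert (Hinv : 0 < / INR m) by (apply Rinv_0_lt_compat; auto).
    assert (0 <= (2 * / INR m) * (snd (B j i) - snd (B (S (S j)) i))) by lra.
    apply Rmult_le_reg_l with (2 * / INR m); lra. }
  assert (Hsum : fsum (fun j => fsum (e j) h) m <= INR h * (2 * D)).
  { rewrite fsum_exchange, <- fsum_const; apply fsum_le; intros i Hi.
    unfold e; rewrite (fsum_telescope2 (fun j => snd (B j i))).
    destruct (HB 0%nat i Hi) as [_ [P0' _]], (HB 1%nat i Hi) as [_ [P1 _]],
      (HB m i Hi) as [_ [P2 _]], (HB (S m) i Hi) as [_ [P3 _]].
    pose proof (Rle_trans _ _ _ (abs_snd_le_dist _ _) (HD _ _ P0' P2)) as E1.
    pose proof (Rle_trans _ _ _ (abs_snd_le_dist _ _) (HD _ _ P1 P3)) as E2.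
    apply Rabs_le_between in E1; apply Rabs_le_between in E2; lra. }
  (* For this [j] the holes cost at most [2 * h * D / m] in total. *)
  destruct (fsum_le_average (fun j => fsum (e j) h) m Hm) as [j [Hj Havg]].
  set (tau := INR (S j) / INR m).
  assert (Htau : 0 <= tau <= 2).
  { unfold tau; split.
    - apply Rle_mult_inv_pos; [apply pos_INR|auto].
    - apply Rmult_le_reg_r with (INR m); auto.
      unfold Rdiv; rewrite Rmult_assoc, Rinv_l by lra.
      assert (INR (S j) <= INR m) by (apply le_INR; lia). lra. }
  assert (Ht0 : tau - / INR m = INR j / INR m) by (unfold tau; rewrite S_INR; field; lra).
  assert (Ht2 : tau + / INR m = INR (S (S j)) / INR m) by (unfold tau; rewrite !S_INR; field; lra).
  assert (Hsqrt : 1 <= sqrt (INR h)).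
  { rewrite <- sqrt_1; apply sqrt_le_1_alt; apply (le_INR 1); auto. }
  assert (Hhh : sqrt (INR h) * sqrt (INR h) = INR h) by (apply sqrt_sqrt, pos_INR).
  (* On [P], [X] exceeds its value at [s] by at most [3 * D]. With [m <= 2 * sqrt h] the terms are
     at most [(3 + 18 * sqrt h) * D], [12 * sqrt h * D] and [2 * D], and [sqrt h >= 1]. *)
  assert (Hone : forall s, P s -> reach P s Rt (35 * sqrt (INR h) * D)).
  { intros s Hs.
    assert (HD0 : 0 <= D) by (eapply Rle_trans; [apply (dist_nonneg s s)|apply HD; auto]).
    eapply reach_le.
    - apply (reach_rightmost_tolls h P P0 H L0 L D Rt m tau (lin (1, tau) s + 3 * D) Top Bot (B j) (B (S (S j))));
        auto.
      + intros q Hq.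
        pose proof (Rle_trans _ _ _ (abs_snd_le_dist _ _) (HD _ _ Hq Hs)) as E1.
        pose proof (Rle_trans _ _ _ (abs_fst_le_dist _ _) (HD _ _ Hq Hs)) as E2.
        apply Rabs_le_between in E1; apply Rabs_le_between in E2.
        unfold lin; cbn [fst snd]; nra.
      + intros i Hi.
        destruct (HTop i Hi) as [T1 [_ T3]], (HBot i Hi) as [U1 [_ U3]].
        destruct (HB j i Hi) as [V1 [_ V3]], (HB (S (S j)) i Hi) as [W1 [_ W3]].
        rewrite Ht0, Ht2.
        assert (HV : forall v, In v (L i) -> H i v) by (apply (HL i Hi)).
        split; [auto|]; split.
        { intros v Hv; specialize (T3 v (HV v Hv)); unfold lin in T3; cbn [fst snd] in T3; lra. }
        split; [auto|]; split.
        { intros v Hv; specialize (U3 v (HV v Hv)); unfold lin in U3; cbn [fst snd] in U3; lra. }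
        repeat (split; [auto|]). apply (He j i Hi).
    - pose proof (tolls_bounds tau Top Bot (e j) h s (fun i Hi => He j i Hi)) as [_ Hb].
      fold (e j).
      assert (Hej : fsum (e j) h <= 2 * sqrt (INR h) * D).
      { apply Rmult_le_reg_l with (INR m); auto.
        eapply Rle_trans; [exact Havg|]; eapply Rle_trans; [exact Hsum|].
        assert (Hsd : 0 <= 2 * sqrt (INR h) * D) by nra.
        replace (INR h * (2 * D)) with (sqrt (INR h) * (2 * sqrt (INR h) * D))
          by (rewrite <- Hhh at 3; ring).
        apply Rmult_le_compat_r; auto. }
      assert (INR m * D <= 2 * sqrt (INR h) * D) by nra.
      assert (D <= sqrt (INR h) * D) by nra.
      lra. }
  intros s t Hs Ht.
  eapply reach_le; [eapply reach_trans; [apply Hone; auto|apply reach_sym, Hone; auto]|lra].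
Qed.

Lemma g_upper (h : nat) : (1 <= h)%nat -> Rbar_le (g h) (Finite (70 * sqrt (INR h))).
Proof.
  intros Hh; unfold g; apply Lub_Rbar_correct; intros r [P [HC Hr]].
  eapply Rbar_le_trans; [exact Hr|].
  destruct (diam2_positive h P HC) as (D & HDeq & HDpos & HD).
  unfold distortion; rewrite HDeq; simpl real.
  assert (Hdg : Rbar_le (diamg P) (Finite (70 * sqrt (INR h) * D))).
  { unfold diamg; apply Lub_Rbar_correct; intros x (s & t & Hs & Ht & Hx).
    eapply Rbar_le_trans; [exact Hx|].
    destruct (domain_reach h P D Hh HC HD s t Hs Ht) as [l [Hl Hlen]].
    apply Rbar_le_trans with (Finite (path_len s l t)); [|exact Hlen].
    unfold geod; apply Glb_Rbar_correct; exists l; auto. }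
  assert (Hinv : 0 < / D) by (apply Rinv_0_lt_compat; auto).
  destruct (diamg P) as [x| |]; simpl in Hdg.
  - simpl. apply Rmult_le_reg_r with D; auto.
    rewrite Rmult_assoc, Rinv_l; lra.
  - destruct Hdg.
  - simpl. destruct (Rle_dec 0 (/ D)) as [Hle|]; [|lra].
    destruct (Rle_lt_or_eq_dec 0 (/ D) Hle); simpl; auto; lra.
Qed.

(** * Boxes, crossings and trigonometry *)

Definition dir (x : R) : point := (cos x, sin x).
Definition nrm (x : R) : point := (- sin x, cos x).

Lemma lin_dir_add (x y : R) (p : point) :
  lin (dir (x + y)) p = cos y * lin (dir x) p + sin y * lin (nrm x) p.
Proof. unfold lin, dir, nrm; simpl; rewrite cos_plus, sin_plus; ring. Qed.

Lemma lin_nrm_add (x y : R) (p : point) :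
  lin (nrm (x + y)) p = cos y * lin (nrm x) p - sin y * lin (dir x) p.
Proof. unfold lin, dir, nrm; simpl; rewrite cos_plus, sin_plus; ring. Qed.

Lemma cos2_sin2 (x : R) : cos x * cos x + sin x * sin x = 1.
Proof. pose proof (sin2_cos2 x); unfold Rsqr in *; lra. Qed.

Lemma frame_coords (x : R) (p : point) :
  fst p = lin (dir x) p * cos x - lin (nrm x) p * sin x /\
  snd p = lin (dir x) p * sin x + lin (nrm x) p * cos x.
Proof.
  unfold lin, dir, nrm; simpl; pose proof (cos2_sin2 x) as H; split.
  - replace (fst p) with (fst p * (cos x * cos x + sin x * sin x)) at 1 by (rewrite H; ring). ring.
  - replace (snd p) with (snd p * (cos x * cos x + sin x * sin x)) at 1 by (rewrite H; ring). ring.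
Qed.

Lemma lin_dir_dist (x : R) (p q : point) : Rabs (lin (dir x) p - lin (dir x) q) <= dist p q.
Proof. apply lin_unit_le_dist; simpl; pose proof (cos2_sin2 x); lra. Qed.

Lemma lin_nrm_dist (x : R) (p q : point) : Rabs (lin (nrm x) p - lin (nrm x) q) <= dist p q.
Proof. apply lin_unit_le_dist; simpl; pose proof (cos2_sin2 x); lra. Qed.

Definition box (x a1 a2 b1 b2 : R) (p : point) : Prop :=
  a1 <= lin (dir x) p <= a2 /\ b1 <= lin (nrm x) p <= b2.

Lemma box_interior (x a1 a2 b1 b2 : R) (p : point) :
  a1 < lin (dir x) p < a2 -> b1 < lin (nrm x) p < b2 -> interior (box x a1 a2 b1 b2) p.
Proof.
  intros Ha Hb.
  exists (Rmin (Rmin (lin (dir x) p - a1) (a2 - lin (dir x) p))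
               (Rmin (lin (nrm x) p - b1) (b2 - lin (nrm x) p))); split.
  - repeat apply Rmin_glb_lt; lra.
  - intros q Hq.
    apply Rmin_Rgt_l in Hq; destruct Hq as [Hq1 Hq2].
    apply Rmin_Rgt_l in Hq1; apply Rmin_Rgt_l in Hq2; destruct Hq1, Hq2.
    pose proof (lin_dir_dist x p q) as Hd; pose proof (lin_nrm_dist x p q) as Hn.
    apply Rabs_le_between in Hd; apply Rabs_le_between in Hn.
    unfold box; lra.
Qed.

Lemma box_polygon (x a1 a2 b1 b2 : R) :
  a1 < a2 -> b1 < b2 -> convex_polygon (box x a1 a2 b1 b2).
Proof.
  intros Ha Hb; split.
  2: { exists ((a1 + a2) / 2 * cos x - (b1 + b2) / 2 * sin x, (a1 + a2) / 2 * sin x + (b1 + b2) / 2 * cos x).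
       pose proof (cos2_sin2 x) as Hcs; apply box_interior; unfold lin, dir, nrm; simpl.
       - match goal with |- _ < ?e < _ => replace e with ((a1 + a2) / 2 * (cos x * cos x + sin x * sin x)) by ring end.
         rewrite Hcs; lra.
       - match goal with |- _ < ?e < _ => replace e with ((b1 + b2) / 2 * (cos x * cos x + sin x * sin x)) by ring end.
         rewrite Hcs; lra. }
  set (corner := fun a b => (a * cos x - b * sin x, a * sin x + b * cos x) : point).
  exists 4%nat, (fun i => match i with
    | 0%nat => corner a1 b1 | 1%nat => corner a2 b1 | 2%nat => corner a1 b2 | _ => corner a2 b2 end).
  intros p; split.
  - intros [Hpa Hpb].
    set (a := lin (dir x) p) in *; set (b := lin (nrm x) p) in *.
    set (l := (a - a1) / (a2 - a1)); set (m := (b - b1) / (b2 - b1)).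
    assert (Hl : a = a1 + l * (a2 - a1)) by (unfold l; field; lra).
    assert (Hm : b = b1 + m * (b2 - b1)) by (unfold m; field; lra).
    assert (Hl01 : 0 <= l <= 1) by (split; nra).
    assert (Hm01 : 0 <= m <= 1) by (split; nra).
    destruct (frame_coords x p) as [Hpx Hpy]; fold a b in Hpx, Hpy.
    exists (fun i => match i with
      | 0%nat => (1 - l) * (1 - m) | 1%nat => l * (1 - m) | 2%nat => (1 - l) * m | _ => l * m end).
    split; [|split; [|split]].
    + intros i _; destruct i as [|[|[|i]]]; apply Rmult_le_pos; lra.
    + simpl; ring.
    + rewrite Hpx, Hl, Hm; simpl; ring.
    + rewrite Hpy, Hl, Hm; simpl; ring.
  - intros [w [Hw [Hw1 [Hpx Hpy]]]]; simpl in *.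
    pose proof (Hw 0%nat ltac:(lia)); pose proof (Hw 1%nat ltac:(lia)).
    pose proof (Hw 2%nat ltac:(lia)); pose proof (Hw 3%nat ltac:(lia)).
    assert (Hda : lin (dir x) p = (w 0%nat + w 2%nat) * a1 + (w 1%nat + w 3%nat) * a2).
    { unfold lin, dir; simpl; rewrite Hpx, Hpy.
      rewrite <- (Rmult_1_r ((w 0%nat + w 2%nat) * a1 + (w 1%nat + w 3%nat) * a2)), <- (cos2_sin2 x); ring. }
    assert (Hdb : lin (nrm x) p = (w 0%nat + w 1%nat) * b1 + (w 2%nat + w 3%nat) * b2).
    { unfold lin, nrm; simpl; rewrite Hpx, Hpy.
      rewrite <- (Rmult_1_r ((w 0%nat + w 1%nat) * b1 + (w 2%nat + w 3%nat) * b2)), <- (cos2_sin2 x); ring. }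
    unfold box; rewrite Hda, Hdb.
    replace (w 3%nat) with (1 - w 0%nat - w 1%nat - w 2%nat) in * by lra.
    repeat split; nra.
Qed.

Lemma segment_dist (s y x : point) (l : R) :
  0 <= l <= 1 -> fst x = (1 - l) * fst s + l * fst y -> snd x = (1 - l) * snd s + l * snd y ->
  dist s x + dist x y = dist s y.
Proof.
  intros Hl Hx Hy.
  assert (H1 : dist s x = l * dist s y).
  { unfold dist; rewrite Hx, Hy.
    replace ((fst s - ((1 - l) * fst s + l * fst y)) ^ 2 + (snd s - ((1 - l) * snd s + l * snd y)) ^ 2)
      with (l ^ 2 * ((fst s - fst y) ^ 2 + (snd s - snd y) ^ 2)) by ring.
    rewrite sqrt_mult_alt by (apply pow2_ge_0). rewrite sqrt_pow2 by lra; auto. }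
  assert (H2 : dist x y = (1 - l) * dist s y).
  { unfold dist; rewrite Hx, Hy.
    replace (((1 - l) * fst s + l * fst y - fst y) ^ 2 + ((1 - l) * snd s + l * snd y - snd y) ^ 2)
      with ((1 - l) ^ 2 * ((fst s - fst y) ^ 2 + (snd s - snd y) ^ 2)) by ring.
    rewrite sqrt_mult_alt by (apply pow2_ge_0). rewrite sqrt_pow2 by lra; auto. }
  lra.
Qed.

Lemma segment_tail (s y x z : point) : segment s y x -> segment x y z -> segment s y z.
Proof.
  intros [l [Hl [Hx Hy]]] [m [Hm [Hzx Hzy]]]; exists (1 - (1 - l) * (1 - m)).
  split; [split; nra|split].
  - rewrite Hzx, Hx; ring.
  - rewrite Hzy, Hy; ring.
Qed.

(** The exit parameter is the least one among the half-planes violated at [y], so the other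
    constraints still hold there. *)
Lemma segment_exit (n : nat) (u : nat -> point) (c : R) (s y : point) :
  (forall j, (j < n)%nat -> lin (u j) s <= c) -> (exists j, (j < n)%nat /\ c < lin (u j) y) ->
  exists x, segment s y x /\ dist s x + dist x y = dist s y /\
    (forall j, (j < n)%nat -> lin (u j) x <= c) /\ (exists j, (j < n)%nat /\ lin (u j) x = c).
Proof.
  intros Hs [j0 [Hj0 Hy0]].
  destruct (list_argmin (fun j => (c - lin (u j) s) / (lin (u j) y - lin (u j) s))
    (fun j => c < lin (u j) y) (seq 0 n)) as [k [Hk [Hky Hmin]]].
  { exists j0; split; auto; apply in_seq; lia. }
  apply in_seq in Hk.
  assert (Hsk := Hs k ltac:(lia)).
  set (l := (c - lin (u k) s) / (lin (u k) y - lin (u k) s)) in *.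
  assert (Hl : l * (lin (u k) y - lin (u k) s) = c - lin (u k) s) by (unfold l; field; lra).
  assert (Hl01 : 0 <= l <= 1) by (split; nra).
  set (x := ((1 - l) * fst s + l * fst y, (1 - l) * snd s + l * snd y) : point).
  assert (Hlin : forall w, lin w x = lin w s + l * (lin w y - lin w s))
    by (intros w; unfold lin, x; simpl; ring).
  exists x; split; [exists l; auto|]; split; [apply (segment_dist s y x l); auto|]; split.
  - intros j Hj; rewrite Hlin; specialize (Hs j Hj).
    destruct (Rle_lt_dec (lin (u j) y) c) as [Hle|Hlt]; [nra|].
    specialize (Hmin j ltac:(apply in_seq; lia) Hlt).
    apply Rmult_le_compat_r with (r := lin (u j) y - lin (u j) s) in Hmin; [|lra].
    replace ((c - lin (u j) s) / (lin (u j) y - lin (u j) s) * (lin (u j) y - lin (u j) s))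
      with (c - lin (u j) s) in Hmin by (field; lra).
    lra.
  - exists k; split; [lia|]; rewrite Hlin; lra.
Qed.

(** The rest of the path comes with an inequality between lengths, so that the costs of successive
    crossings add up. *)
Lemma path_exit (n : nat) (u : nat -> point) (c : R) (P : point -> Prop) (t : point) (l : list point) :
  (exists j, (j < n)%nat /\ c < lin (u j) t) ->
  forall s, path_in P s l t -> (forall j, (j < n)%nat -> lin (u j) s <= c) ->
  exists x l', P x /\ (forall j, (j < n)%nat -> lin (u j) x <= c) /\
    (exists j, (j < n)%nat /\ lin (u j) x = c) /\ path_in P x l' t /\
    dist s x + path_len x l' t <= path_len s l t.
Proof.
  intros Ht; induction l as [|y l IH]; simpl; intros s Hpath Hs.
  - destruct (segment_exit n u c s t Hs Ht) as (x & Hx & Hd & Hin & Hon).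
    exists x, nil; split; [auto|]; split; [auto|]; split; [auto|]; split; simpl; [|lra].
    intros z Hz; apply Hpath; eapply segment_tail; eauto.
  - destruct Hpath as [Hseg Hpath].
    destruct (classic (exists j, (j < n)%nat /\ c < lin (u j) y)) as [Hout|Hin'].
    + destruct (segment_exit n u c s y Hs Hout) as (x & Hx & Hd & Hin & Hon).
      exists x, (y :: l); split; [auto|]; split; [auto|]; split; [auto|]; split; simpl; [|lra].
      split; auto. intros z Hz; apply Hseg; eapply segment_tail; eauto.
    + assert (Hy : forall j, (j < n)%nat -> lin (u j) y <= c)
        by (intros j Hj; apply Rnot_lt_le; intros Hlt; apply Hin'; eauto).
      destruct (IH y Hpath Hy) as (x & l' & HPx & Hin & Hon & Hp & Hlen).
      exists x, l'; split; [auto|]; split; [auto|]; split; [auto|]; split; [auto|].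
      pose proof (dist_triangle s y x); lra.
Qed.

Lemma dist_le_path_len (t : point) (l : list point) : forall s, dist s t <= path_len s l t.
Proof.
  induction l as [|y l IH]; simpl; intros s; [lra|].
  specialize (IH y); pose proof (dist_triangle s y t); lra.
Qed.

Lemma periodic_Z (f : R -> R) (T : R) :
  (forall x, f (x + T) = f x) -> forall (z : Z) (x : R), f (x + IZR z * T) = f x.
Proof.
  intros Hf.
  assert (Hn : forall (n : nat) x, f (x + INR n * T) = f x).
  { induction n as [|n IH]; intros x; [simpl; f_equal; ring|].
    rewrite S_INR; replace (x + (INR n + 1) * T) with ((x + INR n * T) + T) by ring.
    rewrite Hf; auto. }
  intros z x; destruct (Z_le_gt_dec 0 z) as [Hz|Hz].
  - rewrite <- (Z2Nat.id z) by lia; rewrite <- INR_IZR_INZ; auto.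
  - rewrite <- (Hn (Z.to_nat (- z)) (x + IZR z * T)).
    rewrite INR_IZR_INZ, Z2Nat.id, opp_IZR by lia; f_equal; ring.
Qed.

Lemma sin_sqr_period (z : Z) (x : R) : sin (x + IZR z * PI) ^ 2 = sin x ^ 2.
Proof.
  apply (periodic_Z (fun x => sin x ^ 2)); intros y.
  rewrite neg_sin; ring.
Qed.

(** Reducing [o] modulo [k] puts the angle between [PI / k] and [PI - PI / k], where the sine is
    smallest at the ends. *)
Lemma sin_multiple_lower (k : Z) (o : Z) :
  (0 < k)%Z -> (o mod k <> 0)%Z -> sin (PI / IZR k) ^ 2 <= sin (IZR o * (PI / IZR k)) ^ 2.
Proof.
  intros Hk Ho.
  assert (Hkr : 0 < IZR k) by (apply (IZR_lt 0); auto).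
  pose proof (Z.mod_pos_bound o k Hk) as Hr.
  set (r := (o mod k)%Z) in *.
  replace (IZR o * (PI / IZR k)) with (IZR r * (PI / IZR k) + IZR (o / k) * PI).
  2: { rewrite (Z.div_mod o k) at 2 by lia; rewrite plus_IZR, mult_IZR; fold r; field; lra. }
  rewrite sin_sqr_period.
  pose proof PI_RGT_0 as Hpi.
  set (b := PI / IZR k) in *.
  assert (Hb : 0 < b) by (apply Rdiv_lt_0_compat; auto).
  assert (Hkb : IZR k * b = PI) by (unfold b; field; lra).
  assert (H1 : 1 <= IZR r) by (apply (IZR_le 1); lia).
  assert (H2 : IZR r <= IZR k - 1) by (rewrite <- minus_IZR; apply IZR_le; lia).
  assert (Hx1 : b <= IZR r * b) by nra.
  assert (Hx2 : IZR r * b <= PI - b) by nra.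
  assert (Hs : 0 <= sin b) by (apply sin_ge_0; lra).
  assert (Hlow : sin b <= sin (IZR r * b)).
  { destruct (Rle_lt_dec (IZR r * b) (PI / 2)) as [Hle|Hgt].
    - apply sin_incr_1; lra.
    - rewrite <- (sin_PI_x (IZR r * b)). apply sin_incr_1; lra. }
  apply pow_incr; lra.
Qed.

(** Used with [n * x = PI / 2], where it bounds the sine of a small angle from below. *)
Lemma sin_nat_mult (n : nat) (x : R) : Rabs (sin (INR n * x)) <= INR n * Rabs (sin x).
Proof.
  induction n as [|n IH].
  - simpl; rewrite !Rmult_0_l, sin_0, Rabs_R0; lra.
  - rewrite S_INR; replace ((INR n + 1) * x) with (INR n * x + x) by ring.
    rewrite sin_plus.
    eapply Rle_trans; [apply Rabs_triang|]; rewrite !Rabs_mult.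
    assert (Hc : forall y, Rabs (cos y) <= 1) by (intros y; apply Rabs_le; apply COS_bound).
    pose proof (Hc x); pose proof (Hc (INR n * x)).
    pose proof (Rabs_pos (sin x)); pose proof (Rabs_pos (sin (INR n * x))). nra.
Qed.

Lemma cos_lower (x : R) : 0 <= x -> 1 - x ^ 2 / 2 <= cos x.
Proof.
  intros Hx; replace x with (2 * (x / 2)) at 2 by field; rewrite cos_2a_sin.
  assert (H : sin (x / 2) ^ 2 <= (x / 2) ^ 2); [|lra].
  rewrite <- (pow2_abs (sin (x / 2))); apply pow_incr; split; [apply Rabs_pos|].
  apply Rabs_le; destruct Hx as [Hx|<-].
  - split; [|left; apply sin_lt_x; lra].
    pose proof (sin_lt_x (x / 2) ltac:(lra)).
    destruct (Rle_lt_dec (x / 2) PI) as [Hle|Hgt].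
    + pose proof (sin_ge_0 (x / 2) ltac:(lra) Hle); lra.
    + pose proof (SIN_bound (x / 2)); pose proof PI2_1; lra.
  - replace (0 / 2) with 0 by field; rewrite sin_0; lra.
Qed.

(** * Nested rings of holes *)

(** Half the angle between neighbouring normals of a regular [8q]-gon. *)
Definition step (q : nat) : R := PI / (8 * INR q).
Definition rad (q i : nat) : R := 1 + INR i / INR q ^ 2.
Definition thick (q : nat) : R := / (100 * INR q ^ 2).
(** A full side at distance [rad - thick] has half-length [(rad - thick) * tan step]. The sine in
    place of the tangent and the factor 15/16 leave gaps at the corners and keep the hole strictly
    inside its sector. *)
Definition half_length (q i : nat) : R := 15 / 16 * (rad q i - thick q) * sin (step q).

(* Ring [i] has its normals at the angles [ang q i z], [z] an integer modulo [8q]; the parity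
   shift by [i] makes consecutive rings rotated by half a side. *)
Definition ang (q i : nat) (z : Z) : R := IZR (2 * z + Z.of_nat i) * step q.

Definition ring_hole (q i : nat) (z : Z) : point -> Prop :=
  box (ang q i z) (rad q i - thick q) (rad q i) (- half_length q i) (half_length q i).

(** The regular [8q]-gon with sides at distance [c]. With [z] ranging over all integers, normals are
    shifted without reduction modulo [8q]; [in_ring_of_finite] returns to one period. *)
Definition in_ring (q i : nat) (c : R) (p : point) : Prop :=
  forall z : Z, lin (dir (ang q i z)) p <= c.

(** From [PI <= 4], half of [step q ^ 2] is at most [1 / (8 q^2)], which gives the bound on the
    cosine. Later estimates use [e = 1 / q^2] as their unit. *)
Lemma step_facts (q : nat) : (1 <= q)%nat ->
  0 < / INR q ^ 2 <= 1 /\ 0 < sin (step q) /\ 1 - / INR q ^ 2 / 8 <= cos (step q) <= 1 /\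
  thick q = / INR q ^ 2 / 100.
Proof.
  intros Hq; assert (Hq1 : 1 <= INR q) by (apply (le_INR 1); auto).
  assert (Hq2 : 1 <= INR q ^ 2) by nra.
  assert (Hs : 0 < step q <= PI / 8).
  { unfold step; pose proof PI_RGT_0; split.
    - apply Rdiv_lt_0_compat; lra.
    - apply Rmult_le_compat_l; [lra|]. apply Rinv_le_contravar; lra. }
  pose proof PI_RGT_0; pose proof PI_4.
  split; [|split; [|split]].
  - split; [apply Rinv_0_lt_compat; lra|]. rewrite <- Rinv_1; apply Rinv_le_contravar; lra.
  - apply sin_gt_0; lra.
  - split; [|apply COS_bound].
    eapply Rle_trans; [|apply cos_lower; lra].
    assert (Hsq : step q ^ 2 = PI ^ 2 / 64 * / INR q ^ 2) by (unfold step; field; lra).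
    rewrite Hsq. assert (0 < / INR q ^ 2) by (apply Rinv_0_lt_compat; lra).
    assert (PI ^ 2 <= 16) by nra.
    assert (PI ^ 2 * / INR q ^ 2 <= 16 * / INR q ^ 2) by (apply Rmult_le_compat_r; lra).
    lra.
  - unfold thick; field; lra.
Qed.

Lemma rad_bounds (q i : nat) : (1 <= q)%nat -> (i <= q * q)%nat -> 1 <= rad q i <= 2.
Proof.
  intros Hq Hi; unfold rad.
  assert (Hq1 : 1 <= INR q) by (apply (le_INR 1); auto).
  apply le_INR in Hi; rewrite mult_INR in Hi; pose proof (pos_INR i).
  assert (Hq2 : 0 < INR q ^ 2) by nra.
  split.
  - assert (0 <= INR i / INR q ^ 2) by (apply Rle_mult_inv_pos; auto); lra.
  - assert (INR i / INR q ^ 2 <= 1); [|lra].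
    apply Rmult_le_reg_r with (INR q ^ 2); auto.
    unfold Rdiv; rewrite Rmult_assoc, Rinv_l by lra; nra.
Qed.

Lemma rad_S (q i : nat) : rad q (S i) = rad q i + / INR q ^ 2.
Proof. unfold rad; rewrite S_INR; unfold Rdiv; ring. Qed.

Lemma ang_shift (q i : nat) (y z : Z) : ang q i (y + z) = ang q i y + 2 * (IZR z * step q).
Proof. unfold ang; rewrite !plus_IZR, !mult_IZR, plus_IZR; ring. Qed.

Lemma ang_S (q i : nat) (z : Z) : ang q (S i) z = ang q i z + step q.
Proof. unfold ang; rewrite !plus_IZR, Nat2Z.inj_succ, succ_IZR; ring. Qed.

Lemma step_Z (q : nat) : (1 <= q)%nat -> step q = PI / IZR (8 * Z.of_nat q).
Proof. intros; unfold step; rewrite mult_IZR, <- INR_IZR_INZ; reflexivity. Qed.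

(* [|b| cos(step) < a sin(step)] says that [p] lies strictly inside the angular sector of
   half-width [step] around its normal, where that normal dominates all the others of the ring. *)
Lemma sector_dominates (q i : nat) (p : point) (y d : Z) :
  (1 <= q)%nat -> 0 < lin (dir (ang q i y)) p ->
  Rabs (lin (nrm (ang q i y)) p) * cos (step q) < lin (dir (ang q i y)) p * sin (step q) ->
  lin (dir (ang q i (y + d))) p <= lin (dir (ang q i y)) p /\
  ((d mod (8 * Z.of_nat q) <> 0)%Z ->
    lin (dir (ang q i (y + d))) p < lin (dir (ang q i y)) p).
Proof.
  intros Hq Ha Hb; destruct (step_facts q Hq) as (He & HS & HC & _).
  rewrite ang_shift, lin_dir_add, cos_2a_sin, sin_2a.
  set (a := lin (dir (ang q i y)) p) in *; set (b := lin (nrm (ang q i y)) p) in *.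
  set (x := IZR d * step q) in *.
  assert (Hstrict : (d mod (8 * Z.of_nat q) <> 0)%Z ->
    (1 - 2 * sin x * sin x) * a + 2 * sin x * cos x * b < a).
  { intros Hd.
    pose proof (sin_multiple_lower (8 * Z.of_nat q) d ltac:(lia) Hd) as Hlow.
    rewrite <- step_Z in Hlow by auto; fold x in Hlow.
    pose proof (cos2_sin2 x) as E1; pose proof (cos2_sin2 (step q)) as E2.
    assert (Habs : sin (step q) <= Rabs (sin x)).
    { rewrite <- (Rabs_pos_eq (sin (step q))) by lra; apply Rsqr_le_abs_0; unfold Rsqr; lra. }
    assert (Hcos : Rabs (cos x) <= cos (step q)).
    { rewrite <- (Rabs_pos_eq (cos (step q))) by lra; apply Rsqr_le_abs_0; unfold Rsqr; lra. }
    assert (Hprod : sin x * cos x * b <= Rabs (sin x) * (Rabs (cos x) * Rabs b)).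
    { rewrite <- !Rabs_mult, <- Rmult_assoc; apply Rle_abs. }
    assert (Hss : sin x * sin x = Rabs (sin x) * Rabs (sin x)).
    { rewrite <- Rabs_mult, Rabs_pos_eq; [auto|nra]. }
    pose proof (Rabs_pos b) as Hbp. pose proof (Rabs_pos (cos x)).
    assert (H1 : Rabs (cos x) * Rabs b < a * Rabs (sin x)) by nra.
    assert (H2 : Rabs (sin x) * (Rabs (cos x) * Rabs b) < Rabs (sin x) * (a * Rabs (sin x)))
      by (apply Rmult_lt_compat_l; lra).
    nra. }
  split; [|exact Hstrict].
  destruct (Z.eq_dec (d mod (8 * Z.of_nat q)) 0) as [Hd|Hd]; [|left; auto].
  assert (Hx : x = 0 + IZR (d / (8 * Z.of_nat q)) * PI).
  { unfold x; rewrite (Z.div_mod d (8 * Z.of_nat q)) at 1 by lia.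
    rewrite Hd, step_Z, Z.add_0_r, mult_IZR by auto; field.
    apply not_0_IZR; lia. }
  assert (Hsin : sin x ^ 2 = 0) by (rewrite Hx, sin_sqr_period, sin_0; ring).
  assert (Hs0 : sin x = 0) by nra.
  rewrite Hs0; lra.
Qed.

Lemma ring_hole_sector (q i : nat) (z : Z) (p : point) :
  (1 <= q)%nat -> (i <= q * q)%nat -> ring_hole q i z p ->
  0 < lin (dir (ang q i z)) p /\
  Rabs (lin (nrm (ang q i z)) p) * cos (step q) < lin (dir (ang q i z)) p * sin (step q).
Proof.
  intros Hq Hi [Ha Hb]; destruct (step_facts q Hq) as (He & HS & HC & Ht).
  pose proof (rad_bounds q i Hq Hi) as HR.
  unfold half_length in Hb; rewrite Ht in *.
  set (r := rad q i - / INR q ^ 2 / 100) in *.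
  assert (Hr : 0 < r) by (unfold r; lra).
  assert (HrS : 0 < r * sin (step q)) by nra.
  assert (Hb' : Rabs (lin (nrm (ang q i z)) p) <= 15 / 16 * r * sin (step q))
    by (apply Rabs_le; lra).
  split; [lra|].
  pose proof (Rabs_pos (lin (nrm (ang q i z)) p)). nra.
Qed.

Lemma ring_hole_in_ring (q i : nat) (z : Z) (p : point) :
  (1 <= q)%nat -> (i <= q * q)%nat -> ring_hole q i z p -> in_ring q i (rad q i) p.
Proof.
  intros Hq Hi Hp z'; destruct (ring_hole_sector q i z p Hq Hi Hp) as [H1 H2].
  pose proof (proj1 (sector_dominates q i p z (z' - z) Hq H1 H2)) as H3.
  replace (z + (z' - z))%Z with z' in H3 by lia.
  destruct Hp as [[_ Hp] _]; lra.
Qed.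

(** The two normals of ring [i] adjacent to a normal of ring [i+1] add up to [2 * cos step] times
    it. *)
Lemma in_ring_next (q i : nat) (c : R) (p : point) :
  in_ring q i c p -> forall z, lin (dir (ang q (S i) z)) p * cos (step q) <= c.
Proof.
  intros Hp z; pose proof (Hp z) as H1; pose proof (Hp (z + 1)%Z) as H2.
  rewrite ang_S.
  replace (ang q i z) with ((ang q i z + step q) + - step q) in H1 by ring.
  rewrite ang_shift in H2.
  replace (ang q i z + 2 * (1 * step q)) with ((ang q i z + step q) + step q) in H2 by ring.
  rewrite lin_dir_add in H1; rewrite lin_dir_add in H2.
  rewrite cos_neg, sin_neg in H1; lra.
Qed.

(** Along the normals of ring [i+1], polygon [i] reaches at most [rad / cos step], an excess below
    [e / 3] as [rad <= 2], whereas the radii grow by [e = 1 / q^2]. The case [d = 0] separates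
    holes, [d = thick / 2] nests the walls. *)
Lemma in_ring_step (q i : nat) (d : R) (p : point) :
  (1 <= q)%nat -> (i < q * q)%nat -> 0 <= d <= thick q ->
  in_ring q i (rad q i - d) p ->
  forall z, lin (dir (ang q (S i) z)) p < rad q (S i) - thick q.
Proof.
  intros Hq Hi Hd Hp z; pose proof (in_ring_next q i _ p Hp z) as H1.
  destruct (step_facts q Hq) as (He & HS & HC & Ht).
  pose proof (rad_bounds q i Hq ltac:(lia)) as HR.
  rewrite rad_S, Ht in *. set (e := / INR q ^ 2) in *.
  apply Rnot_le_lt; intros Hle.
  assert ((rad q i + e - e / 100) * (1 - e / 8) <= lin (dir (ang q (S i) z)) p * cos (step q)).
  { apply Rmult_le_compat; lra. }
  nra.
Qed.

Lemma in_ring_mono (q i j : nat) (p : point) :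
  (1 <= q)%nat -> (i <= j)%nat -> (j <= q * q)%nat ->
  in_ring q i (rad q i) p -> in_ring q j (rad q j) p.
Proof.
  intros Hq Hij Hj Hp; induction Hij as [|j Hij IH]; auto.
  assert (Ht : 0 < thick q).
  { destruct (step_facts q Hq) as (He & _ & _ & ->); lra. }
  intros z; pose proof (in_ring_step q j 0 p Hq ltac:(lia) ltac:(lra)) as H.
  rewrite Rminus_0_r in H; specialize (H (IH ltac:(lia)) z); lra.
Qed.

(** Holes of different rings are separated by nesting. In one ring, the normal of a hole strictly
    dominates the others on that hole, which a common point would contradict in both directions. *)
Lemma ring_holes_disjoint (q i j : nat) (y z : Z) (p : point) :
  (1 <= q)%nat -> (i < q * q)%nat -> (j < q * q)%nat ->
  (0 <= y < 8 * Z.of_nat q)%Z -> (0 <= z < 8 * Z.of_nat q)%Z -> (i <> j \/ y <> z) ->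
  ring_hole q i y p -> ring_hole q j z p -> False.
Proof.
  intros Hq Hi Hj Hy Hz Hne Hpi Hpj.
  assert (Hlt : forall i j y z, (i < j)%nat -> (j < q * q)%nat ->
    ring_hole q i y p -> ring_hole q j z p -> False).
  { clear - Hq; intros i j y z Hij Hj Hpi Hpj; destruct j as [|j]; [lia|].
    assert (Hr : in_ring q j (rad q j) p).
    { apply (in_ring_mono q i j p); auto; try lia. apply (ring_hole_in_ring q i y); auto; lia. }
    assert (Ht : 0 < thick q).
    { destruct (step_facts q Hq) as (He & _ & _ & ->); lra. }
    pose proof (in_ring_step q j 0 p Hq ltac:(lia) ltac:(lra)) as H.
    rewrite Rminus_0_r in H; specialize (H Hr z).
    destruct Hpj as [[Hpj _] _]; lra. }
  destruct (Nat.lt_trichotomy i j) as [H|[H|H]]; [eauto| |eauto].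
  subst j; destruct Hne as [|Hne]; [auto|].
  assert (Hstrict : forall y z, (0 <= y < 8 * Z.of_nat q)%Z -> (0 <= z < 8 * Z.of_nat q)%Z -> y <> z ->
    ring_hole q i y p -> lin (dir (ang q i z)) p < lin (dir (ang q i y)) p).
  { clear - Hq Hi; intros y z Hy Hz Hne Hp.
    destruct (ring_hole_sector q i y p Hq ltac:(lia) Hp) as [H1 H2].
    pose proof (proj2 (sector_dominates q i p y (z - y) Hq H1 H2)) as H3.
    replace (y + (z - y))%Z with z in H3 by lia.
    apply H3; intros Hm.
    apply Z.mod_divide in Hm; [|lia]; destruct Hm as [k Hk].
    destruct (Z.lt_trichotomy k 0) as [Hk0|[->|Hk0]]; [nia|lia|nia]. }
  pose proof (Hstrict y z Hy Hz Hne Hpi); pose proof (Hstrict z y Hz Hy ltac:(auto) Hpj); lra.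
Qed.

Lemma ring_hole_bounded (q i : nat) (z : Z) (p : point) :
  (1 <= q)%nat -> (i <= q * q)%nat -> ring_hole q i z p ->
  -4 <= fst p <= 4 /\ -4 <= snd p <= 4.
Proof.
  intros Hq Hi [Ha Hb]; destruct (step_facts q Hq) as (He & HS & HC & Ht).
  pose proof (rad_bounds q i Hq Hi) as HR.
  destruct (frame_coords (ang q i z) p) as [-> ->].
  pose proof (SIN_bound (step q)) as HS1.
  unfold half_length in Hb; rewrite Ht in *.
  set (e := / INR q ^ 2) in *.
  set (a := lin (dir (ang q i z)) p) in *; set (b := lin (nrm (ang q i z)) p) in *.
  assert (Ha' : 0 <= a <= 2) by lra.
  assert (Hb' : -2 <= b <= 2) by nra.
  pose proof (SIN_bound (ang q i z)); pose proof (COS_bound (ang q i z)).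
  set (c := cos (ang q i z)) in *; set (s := sin (ang q i z)) in *.
  clear - Ha' Hb' H H0. repeat split; nra.
Qed.

(* [x] is within a small angle of a corner direction of ring [i]; these are the normal
   directions of ring [i+1]. *)
Definition near_corner (q i : nat) (x : point) : Prop :=
  exists z : Z, 4 / 5 * rad q i <= lin (dir (ang q (S i) z)) x /\
    Rabs (lin (nrm (ang q (S i) z)) x) <= 1 / 5 * rad q i * sin (step q).

(** Halfway through the thickness of the holes, so that a path crossing this polygon must use a gap
    between them. *)
Definition wall (q i : nat) : R := rad q i - thick q / 2.

(** The hole bounds [|b|] from below and the neighbouring sides bound it from above. Turning the
    frame by [step] towards the corner leaves a small tangential coordinate; its bound 1/5 comes
    from [1 - 15/16 * 7/8 < 1/5], where [cos step >= 7/8]. *)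
Lemma wall_gap (q i : nat) (z : Z) (x : point) :
  (1 <= q)%nat -> (i <= q * q)%nat -> in_ring q i (wall q i) x ->
  lin (dir (ang q i z)) x = wall q i -> ~ interior (ring_hole q i z) x -> near_corner q i x.
Proof.
  intros Hq Hi Hin Hon Hni; destruct (step_facts q Hq) as (He & HS & HC & Ht).
  pose proof (rad_bounds q i Hq Hi) as HR.
  set (b := lin (nrm (ang q i z)) x).
  assert (Hlong : half_length q i <= Rabs b).
  { apply Rnot_lt_le; intros Hlt; apply Hni, box_interior.
    - rewrite Hon; unfold wall; lra.
    - apply Rabs_lt_between in Hlt; exact Hlt. }
  pose proof (Hin (z + 1)%Z) as Hp1; pose proof (Hin (z + -1)%Z) as Hm1.
  rewrite ang_shift, lin_dir_add, cos_2a_sin, sin_2a, Hon in Hp1, Hm1; fold b in Hp1, Hm1.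
  replace (1 * step q) with (step q) in Hp1 by ring.
  replace (-1 * step q) with (- step q) in Hm1 by ring.
  rewrite sin_neg, cos_neg in Hm1.
  unfold half_length, wall in *; rewrite Ht in *.
  set (e := / INR q ^ 2) in *; set (S0 := sin (step q)) in *; set (C0 := cos (step q)) in *.
  set (r := rad q i) in *.
  assert (Hup : b * C0 <= (r - e / 100 / 2) * S0) by nra.
  assert (Hdn : - b * C0 <= (r - e / 100 / 2) * S0) by nra.
  assert (Hmain : 15 / 16 * (r - e / 100) * S0 * C0 >= (r - e / 100 / 2) * S0 - 1 / 5 * r * S0).
  { assert (Hk : 15 / 16 * (r - e / 100) * C0 >= (r - e / 100 / 2) - 1 / 5 * r) by nra. nra. }
  assert (HCa : 4 / 5 * r <= (r - e / 100 / 2) * C0) by nra.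
  destruct (Rle_lt_dec 0 b) as [Hb|Hb].
  - rewrite Rabs_pos_eq in Hlong by auto.
    exists z; rewrite ang_S, lin_dir_add, lin_nrm_add, Hon; fold b S0 C0 r.
    split; [nra|].
    assert (15 / 16 * (r - e / 100) * S0 * C0 <= b * C0) by (apply Rmult_le_compat_r; lra).
    assert (0 < r * S0) by nra.
    apply Rabs_le; split; lra.
  - rewrite Rabs_left in Hlong by auto.
    exists (z + -1)%Z; rewrite ang_S, ang_shift.
    replace (ang q i z + 2 * (-1 * step q) + step q) with (ang q i z + - step q) by ring.
    rewrite lin_dir_add, lin_nrm_add, cos_neg, sin_neg, Hon; fold b S0 C0 r.
    split; [nra|].
    assert (15 / 16 * (r - e / 100) * S0 * C0 <= - b * C0) by (apply Rmult_le_compat_r; lra).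
    assert (0 < r * S0) by nra.
    apply Rabs_le; split; lra.
Qed.

(* Project on the normal to the bisector of the two corner directions. *)
Lemma near_corner_dist (q i : nat) (x y : point) :
  (1 <= q)%nat -> (S i <= q * q)%nat -> near_corner q i x -> near_corner q (S i) y ->
  1 / (10 * INR q) <= dist x y.
Proof.
  intros Hq Hi [z [Hz1 Hz2]] [w [Hw1 Hw2]]; destruct (step_facts q Hq) as (He & HS & HC & Ht).
  assert (HqR : 1 <= INR q) by (apply (le_INR 1); auto).
  pose proof (rad_bounds q i Hq ltac:(lia)) as HR; pose proof (rad_bounds q (S i) Hq Hi) as HR'.
  set (th := ang q (S i) z) in *; set (th' := ang q (S (S i)) w) in *.
  (* An odd multiple of [step / 2], since normals of consecutive rings differ by odd multiples of
     [step]; hence [|sin psi|] is at least [sin (step / 2)]. *)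
  set (psi := (th - th') / 2).
  assert (Hpsi : psi = IZR (2 * (z - w) - 1) * (PI / IZR (16 * Z.of_nat q))).
  { unfold psi, th, th'; rewrite (ang_S q (S i) w); unfold ang, step.
    repeat rewrite ?plus_IZR, ?minus_IZR, ?mult_IZR; rewrite <- !INR_IZR_INZ; field; lra. }
  assert (Hlow : sin (step q / 2) ^ 2 <= sin psi ^ 2).
  { rewrite Hpsi. replace (step q / 2) with (PI / IZR (16 * Z.of_nat q)).
    - apply sin_multiple_lower; [lia|].
      intros Hm; apply Z.mod_divide in Hm; [|lia]; destruct Hm as [k Hk]; lia.
    - unfold step; rewrite mult_IZR, <- INR_IZR_INZ; field; lra. }
  assert (Hs2 : / (8 * INR q) <= Rabs (sin (step q / 2))).
  { pose proof (sin_nat_mult (8 * q) (step q / 2)) as Hn.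
    replace (INR (8 * q) * (step q / 2)) with (PI / 2) in Hn
      by (rewrite mult_INR; unfold step; simpl; field; lra).
    rewrite sin_PI2, Rabs_R1, mult_INR in Hn; replace (INR 8) with 8 in Hn by (simpl; ring).
    apply Rmult_le_reg_l with (8 * INR q); [lra|]. rewrite Rinv_r by lra; auto. }
  assert (Habs : Rabs (sin (step q / 2)) <= Rabs (sin psi)).
  { apply Rsqr_le_abs_0; unfold Rsqr; lra. }
  assert (HS2 : sin (step q) <= 2 * Rabs (sin psi)).
  { replace (step q) with (2 * (step q / 2)) by field; rewrite sin_2a.
    pose proof (Rle_abs (sin (step q / 2) * cos (step q / 2))) as Hle; rewrite Rabs_mult in Hle.
    assert (Rabs (cos (step q / 2)) <= 1) by (apply Rabs_le, COS_bound).
    pose proof (Rabs_pos (sin (step q / 2))). nra. }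
  pose proof (lin_nrm_dist ((th + th') / 2) x y) as Hd.
  replace (lin (nrm ((th + th') / 2)) x) with
    (cos psi * lin (nrm th) x + sin psi * lin (dir th) x) in Hd.
  2: { replace ((th + th') / 2) with (th + - psi) by (unfold psi; field).
       rewrite lin_nrm_add, cos_neg, sin_neg; ring. }
  replace (lin (nrm ((th + th') / 2)) y) with
    (cos psi * lin (nrm th') y - sin psi * lin (dir th') y) in Hd.
  2: { replace ((th + th') / 2) with (th' + psi) by (unfold psi; field).
       rewrite lin_nrm_add; ring. }
  set (a := lin (dir th) x) in *; set (a' := lin (dir th') y) in *.
  set (b := lin (nrm th) x) in *; set (b' := lin (nrm th') y) in *.
  assert (Htri : Rabs (sin psi) * (a + a') <= dist x y + (Rabs b + Rabs b')).
  { rewrite <- (Rabs_pos_eq (a + a')), <- Rabs_mult by lra.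
    replace (sin psi * (a + a')) with
      ((cos psi * b + sin psi * a - (cos psi * b' - sin psi * a')) + (cos psi * (b' + - b))) by ring.
    eapply Rle_trans; [apply Rabs_triang|]; apply Rplus_le_compat; auto.
    rewrite Rabs_mult; pose proof (Rabs_triang b' (- b)) as Ht2; rewrite Rabs_Ropp in Ht2.
    assert (Rabs (cos psi) <= 1) by (apply Rabs_le, COS_bound).
    pose proof (Rabs_pos (b' + - b)). nra. }
  set (r := rad q i) in *; set (r' := rad q (S i)) in *.
  (* The radial parts give at least [4/5 * (r + r') * |sin psi|], of which the tangential parts
     cancel at most half. As [r + r' >= 2], at least [4/5 * 1 / (8 q)] remains. *)
  assert (Hrr : Rabs b + Rabs b' <= 2 / 5 * (r + r') * Rabs (sin psi)) by nra.
  pose proof (Rabs_pos (sin psi)).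
  assert (Haa : 4 / 5 * (r + r') * Rabs (sin psi) <= Rabs (sin psi) * (a + a')) by nra.
  assert (Hfin : 2 / 5 * 2 * Rabs (sin psi) <= dist x y) by nra.
  replace (1 / (10 * INR q)) with (4 / 5 * / (8 * INR q)) by (field; lra).
  lra.
Qed.

(** * The domain with exactly [h] holes *)

Lemma lin_dir_0 (p : point) : lin (dir 0) p = fst p.
Proof. unfold lin, dir; simpl; rewrite cos_0, sin_0; ring. Qed.

Lemma lin_nrm_0 (p : point) : lin (nrm 0) p = snd p.
Proof. unfold lin, nrm; simpl; rewrite cos_0, sin_0; ring. Qed.

(** Every other interval of length [1 / e] between 5 and 7, so any number [e] of boxes fits to the
    right of the rings. *)
Definition pad_hole (e j : nat) : point -> Prop :=
  box 0 (5 + INR (2 * j) / INR e) (5 + INR (2 * j + 1) / INR e) (-1) 1.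

Definition ring_count (q : nat) : nat := (8 * q * (q * q))%nat.

(* The [8q * q^2] ring holes, completed to [h] holes by small boxes far from the rings. *)
Definition holes (q h n : nat) : point -> Prop :=
  if Nat.ltb n (ring_count q)
  then ring_hole q (n / (8 * q)) (Z.of_nat (n mod (8 * q)))
  else pad_hole (h - ring_count q) (n - ring_count q).

Definition ringed_domain (q h : nat) (p : point) : Prop :=
  box 0 (-10) 10 (-10) 10 p /\ forall i, (i < h)%nat -> ~ interior (holes q h i) p.

Lemma holes_cases (q h n : nat) : (n < h)%nat ->
  ((1 <= q)%nat /\ (n < ring_count q)%nat /\ (n / (8 * q) < q * q)%nat /\ (n mod (8 * q) < 8 * q)%nat /\
    holes q h n = ring_hole q (n / (8 * q)) (Z.of_nat (n mod (8 * q)))) \/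
  ((ring_count q <= n)%nat /\ (n - ring_count q < h - ring_count q)%nat /\
    holes q h n = pad_hole (h - ring_count q) (n - ring_count q)).
Proof.
  intros Hn; unfold holes; destruct (Nat.ltb_spec n (ring_count q)) as [Hlt|Hge].
  - left. assert (Hq : (1 <= q)%nat) by (unfold ring_count in Hlt; nia).
    repeat split; auto.
    + apply Nat.Div0.div_lt_upper_bound; unfold ring_count in Hlt; lia.
    + apply Nat.mod_upper_bound; lia.
  - right; repeat split; auto; lia.
Qed.

Lemma pad_hole_bounds (e j : nat) (p : point) : (j < e)%nat -> pad_hole e j p ->
  INR (2 * j) <= (fst p - 5) * INR e <= INR (2 * j + 1) /\ 5 <= fst p <= 7 /\ -1 <= snd p <= 1.
Proof.
  intros Hj [Ha Hb]; rewrite lin_dir_0 in Ha; rewrite lin_nrm_0 in Hb.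
  assert (He : 0 < INR e) by (apply lt_0_INR; lia).
  assert (H1 : INR (2 * j) = INR (2 * j) / INR e * INR e) by (field; lra).
  assert (H2 : INR (2 * j + 1) = INR (2 * j + 1) / INR e * INR e) by (field; lra).
  assert (H3 : INR (2 * j + 1) <= 2 * INR e).
  { replace (2 * INR e) with (INR (2 * e)) by (rewrite mult_INR; simpl; ring). apply le_INR; lia. }
  pose proof (pos_INR (2 * j)).
  assert (H4 : INR (2 * j) <= (fst p - 5) * INR e) by (rewrite H1; apply Rmult_le_compat_r; lra).
  assert (H5 : (fst p - 5) * INR e <= INR (2 * j + 1)) by (rewrite H2; apply Rmult_le_compat_r; lra).
  split; [auto|split; [|auto]]; split; nra.
Qed.

Lemma ringed_domain_in_C (q h : nat) : in_C h (ringed_domain q h).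
Proof.
  exists (box 0 (-10) 10 (-10) 10), (holes q h).
  split; [apply box_polygon; lra|]; split; [|split; [|split]].
  - intros i Hi; destruct (holes_cases q h i Hi) as [(Hq & _ & Hr & _ & ->)|(_ & Hj & ->)].
    + destruct (step_facts q Hq) as (He & HS & _ & Ht).
      pose proof (rad_bounds q (i / (8 * q)) Hq ltac:(lia)) as HR.
      assert (0 < half_length q (i / (8 * q))).
      { unfold half_length; apply Rmult_lt_0_compat; auto; rewrite Ht; lra. }
      apply box_polygon; [rewrite Ht|]; lra.
    + apply box_polygon; [|lra].
      apply Rplus_lt_compat_l, Rmult_lt_compat_r; [apply Rinv_0_lt_compat, lt_0_INR; lia|].
      apply lt_INR; lia.
  - intros i j Hi Hj Hij p [Hpi Hpj].
    destruct (holes_cases q h i Hi) as [(Hq & Hi1 & Hi2 & Hi3 & Ei)|(Hi1 & Hi2 & Ei)];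
    destruct (holes_cases q h j Hj) as [(Hq' & Hj1 & Hj2 & Hj3 & Ej)|(Hj1 & Hj2 & Ej)];
    rewrite Ei in Hpi; rewrite Ej in Hpj.
    + eapply (ring_holes_disjoint q _ _ _ _ p Hq Hi2 Hj2); [| | |exact Hpi|exact Hpj]; try lia.
      destruct (Nat.eq_dec (i / (8 * q)) (j / (8 * q))) as [E1|E1]; [right|left; auto].
      intros E2; apply Nat2Z.inj in E2; apply Hij.
      rewrite (Nat.div_mod_eq i (8 * q)), (Nat.div_mod_eq j (8 * q)), E1, E2; auto.
    + destruct (ring_hole_bounded q _ _ p Hq ltac:(apply Nat.lt_le_incl; exact Hi2) Hpi).
      destruct (pad_hole_bounds _ _ p Hj2 Hpj); lra.
    + destruct (ring_hole_bounded q _ _ p Hq' ltac:(apply Nat.lt_le_incl; exact Hj2) Hpj).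
      destruct (pad_hole_bounds _ _ p Hi2 Hpi); lra.
    + destruct (pad_hole_bounds _ _ p Hi2 Hpi) as [Bi _].
      destruct (pad_hole_bounds _ _ p Hj2 Hpj) as [Bj _].
      destruct (Nat.lt_trichotomy i j) as [Hlt|[Hlt|Hlt]]; [|auto|].
      * assert (INR (2 * (i - ring_count q) + 1) < INR (2 * (j - ring_count q))) by (apply lt_INR; lia). lra.
      * assert (INR (2 * (j - ring_count q) + 1) < INR (2 * (i - ring_count q))) by (apply lt_INR; lia). lra.
  - intros i Hi x Hx.
    assert (Hb : -10 < fst x < 10 /\ -10 < snd x < 10).
    { destruct (holes_cases q h i Hi) as [(Hq & _ & Hr & _ & E)|(_ & Hj & E)]; rewrite E in Hx.
      - destruct (ring_hole_bounded q _ _ x Hq ltac:(apply Nat.lt_le_incl; exact Hr) Hx); lra.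
      - destruct (pad_hole_bounds _ _ x Hj Hx); lra. }
    apply box_interior; rewrite ?lin_dir_0, ?lin_nrm_0; lra.
  - intros p; unfold ringed_domain; tauto.
Qed.

Lemma in_ring_of_finite (q i : nat) (c : R) (p : point) : (1 <= q)%nat ->
  (forall j, (j < 8 * q)%nat -> lin (dir (ang q i (Z.of_nat j))) p <= c) -> in_ring q i c p.
Proof.
  intros Hq Hfin z.
  assert (Hqz : (0 < 8 * Z.of_nat q)%Z) by lia.
  pose proof (Z.mod_pos_bound z _ Hqz) as Hm.
  specialize (Hfin (Z.to_nat (z mod (8 * Z.of_nat q))) ltac:(lia)).
  rewrite Z2Nat.id in Hfin by lia.
  replace (ang q i z) with
    (ang q i (z mod (8 * Z.of_nat q)) + IZR (z / (8 * Z.of_nat q)) * (2 * PI)).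
  - unfold dir in *.
    rewrite (periodic_Z cos (2 * PI)) by (intros x; rewrite cos_plus, cos_2PI, sin_2PI; ring).
    rewrite (periodic_Z sin (2 * PI)) by (intros x; rewrite sin_plus, cos_2PI, sin_2PI; ring).
    exact Hfin.
  - rewrite (Z.div_mod z (8 * Z.of_nat q)) at 3 by lia.
    rewrite (Z.add_comm (_ * _)), ang_shift, mult_IZR, step_Z by auto.
    field. apply not_0_IZR; lia.
Qed.

(** * The length of a path leaving the rings *)

Definition source : point := (0, 0).
Definition target : point := (-5, 0).

Lemma target_outside (q i : nat) : (1 <= q)%nat -> (i <= q * q)%nat -> ~ in_ring q i (wall q i) target.
Proof.
  intros Hq Hi Hin; destruct (step_facts q Hq) as (He & HS & HC & Ht).
  pose proof (rad_bounds q i Hq Hi) as HR.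
  assert (HqR : 1 <= INR q) by (apply (le_INR 1); auto).
  (* This normal points towards the target exactly, or up to one [step], according to the parity of
     [i]; the projection is at least [5 * 7/8], more than any radius. *)
  specialize (Hin ((8 * Z.of_nat q - Z.of_nat i) / 2)%Z).
  unfold wall in Hin; rewrite Ht in Hin.
  assert (Hang : exists s, (s = 0 \/ s = step q) /\
     ang q i ((8 * Z.of_nat q - Z.of_nat i) / 2) = PI - s).
  { unfold ang. pose proof (Z.div_mod (8 * Z.of_nat q - Z.of_nat i) 2 ltac:(lia)) as Hd.
    pose proof (Z.mod_pos_bound (8 * Z.of_nat q - Z.of_nat i) 2 ltac:(lia)) as Hm.
    assert (Hs : 8 * INR q * step q = PI) by (unfold step; field; lra).
    destruct (Z.eq_dec ((8 * Z.of_nat q - Z.of_nat i) mod 2) 0) as [E|E].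
    - exists 0; split; [auto|].
      replace (2 * ((8 * Z.of_nat q - Z.of_nat i) / 2) + Z.of_nat i)%Z with (8 * Z.of_nat q)%Z by lia.
      rewrite mult_IZR, <- INR_IZR_INZ; lra.
    - exists (step q); split; [auto|].
      replace (2 * ((8 * Z.of_nat q - Z.of_nat i) / 2) + Z.of_nat i)%Z with (8 * Z.of_nat q - 1)%Z by lia.
      rewrite minus_IZR, mult_IZR, <- INR_IZR_INZ; lra. }
  destruct Hang as [s [Hs Hang]]; rewrite Hang in Hin.
  unfold lin, dir, target in Hin; cbn [fst snd] in Hin.
  rewrite Rtrigo_facts.cos_pi_minus in Hin.
  destruct Hs as [-> | ->]; [rewrite cos_0 in Hin|]; lra.
Qed.

Lemma source_inside (q i : nat) : (1 <= q)%nat -> (i <= q * q)%nat -> in_ring q i (wall q i) source.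
Proof.
  intros Hq Hi z; destruct (step_facts q Hq) as (He & _ & _ & Ht).
  pose proof (rad_bounds q i Hq Hi) as HR.
  unfold lin, source, wall; cbn [fst snd]; rewrite Ht; lra.
Qed.

Lemma cross_ring (q h i : nat) (x : point) (l : list point) :
  (1 <= q)%nat -> (ring_count q <= h)%nat -> (i < q * q)%nat ->
  in_ring q i (wall q i) x -> path_in (ringed_domain q h) x l target ->
  exists y l', near_corner q i y /\ in_ring q i (wall q i) y /\
    path_in (ringed_domain q h) y l' target /\
    dist x y + path_len y l' target <= path_len x l target.
Proof.
  intros Hq Hh Hi Hx Hpath.
  destruct (path_exit (8 * q) (fun j => dir (ang q i (Z.of_nat j))) (wall q i) (ringed_domain q h) target l)
    with (s := x) as (y & l' & HPy & Hin & [j [Hj Hon]] & Hp & Hlen); auto.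
  { destruct (classic (exists j, (j < 8 * q)%nat /\ wall q i < lin (dir (ang q i (Z.of_nat j))) target))
      as [H|H]; auto.
    exfalso; apply (target_outside q i Hq); [lia|]; apply in_ring_of_finite; auto.
    intros j Hj; apply Rnot_lt_le; intros Hlt; apply H; eauto. }
  exists y, l'; split; [|split; [|split]]; auto.
  2: apply in_ring_of_finite; auto.
  apply (wall_gap q i (Z.of_nat j)); auto; [lia|apply in_ring_of_finite; auto|].
  assert (Hn : (8 * q * i + j < ring_count q)%nat) by (unfold ring_count; nia).
  pose proof (proj2 HPy (8 * q * i + j)%nat ltac:(lia)) as Hni.
  unfold holes in Hni.
  destruct (Nat.ltb_spec (8 * q * i + j) (ring_count q)) as [_|]; [|lia].
  replace ((8 * q * i + j) / (8 * q))%nat with i in Hni.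
  2: { apply (Nat.div_unique _ _ i j); lia. }
  replace ((8 * q * i + j) mod (8 * q))%nat with j in Hni.
  2: { apply (Nat.mod_unique _ _ i j); lia. }
  exact Hni.
Qed.

(** A point inside wall [i] is inside wall [i+1], so the next crossing is near a corner of ring
    [i+1], at distance at least [1 / (10 q)] from the last one. *)
Lemma remaining_rings_length (q h d : nat) :
  (1 <= q)%nat -> (ring_count q <= h)%nat ->
  forall i x l, (i + d < q * q)%nat -> near_corner q i x -> in_ring q i (wall q i) x ->
    path_in (ringed_domain q h) x l target ->
    INR d * (1 / (10 * INR q)) <= path_len x l target.
Proof.
  intros Hq Hh; induction d as [|d IH]; intros i x l Hi Hc Hx Hp.
  - simpl; rewrite Rmult_0_l; eapply Rle_trans; [apply (dist_nonneg x target)|apply dist_le_path_len].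
  - assert (Ht : 0 < thick q).
    { destruct (step_facts q Hq) as (He & _ & _ & ->); lra. }
    assert (Hx' : in_ring q (S i) (wall q (S i)) x).
    { intros z; left; eapply Rlt_trans.
      - apply (in_ring_step q i (thick q / 2) x Hq ltac:(lia) ltac:(lra) Hx z).
      - unfold wall; lra. }
    destruct (cross_ring q h (S i) x l Hq Hh ltac:(lia) Hx' Hp) as (y & l' & Hcy & Hy & Hp' & Hlen).
    pose proof (IH (S i) y l' ltac:(lia) Hcy Hy Hp').
    pose proof (near_corner_dist q i x y Hq ltac:(lia) Hc Hcy).
    rewrite S_INR; lra.
Qed.

Lemma ringed_domain_path_length (q h : nat) (l : list point) :
  (ring_count q <= h)%nat -> path_in (ringed_domain q h) source l target ->
  (INR q + 1) / 20 <= path_len source l target.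
Proof.
  intros Hh Hp.
  assert (H5 : 5 <= path_len source l target).
  { eapply Rle_trans; [|apply dist_le_path_len]. eapply Rle_trans; [|apply abs_fst_le_dist].
    simpl; rewrite Rabs_pos_eq; lra. }
  (* For [q <= 1] the distance 5 suffices. For [q >= 2], [q^2 - 1] passages between rings give
     [(q^2 - 1) / (10 q) >= (q + 1) / 20]. *)
  destruct q as [|[|q]]; [simpl; lra|simpl; lra|].
  set (k := S (S q)) in *.
  assert (Hk : (2 <= k)%nat) by lia.
  assert (HkR : 2 <= INR k) by (apply (le_INR 2); auto).
  destruct (cross_ring k h 0 source l ltac:(lia) Hh ltac:(nia) (source_inside k 0 ltac:(lia) ltac:(lia)) Hp)
    as (y & l' & Hcy & Hy & Hp' & Hlen).
  pose proof (remaining_rings_length k h (k * k - 1) ltac:(lia) Hh 0 y l' ltac:(nia) Hcy Hy Hp') as Hr.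
  rewrite minus_INR, mult_INR in Hr by nia; simpl (INR 1) in Hr.
  pose proof (dist_nonneg source y).
  eapply Rle_trans; [|eapply Rle_trans; [exact Hr|lra]].
  apply Rmult_le_reg_r with (20 * INR k); [lra|].
  replace ((INR k * INR k - 1) * (1 / (10 * INR k)) * (20 * INR k)) with (2 * (INR k * INR k - 1))
    by (field; lra).
  replace ((INR k + 1) / 20 * (20 * INR k)) with ((INR k + 1) * INR k) by field.
  nra.
Qed.

Lemma source_target_in_domain (q h : nat) :
  ringed_domain q h source /\ ringed_domain q h target.
Proof.
  split; (split; [split; rewrite ?lin_dir_0, ?lin_nrm_0; simpl; lra|]);
  intros i Hi Hint; apply interior_in in Hint;
  destruct (holes_cases q h i Hi) as [(Hq & _ & Hr & _ & E)|(_ & Hj & E)]; rewrite E in Hint.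
  1: { destruct (step_facts q Hq) as (He & _ & _ & Ht).
       pose proof (rad_bounds q (i / (8 * q)) Hq ltac:(lia)) as HR.
       destruct Hint as [[Ha _] _]; unfold lin, source in Ha; cbn [fst snd] in Ha; rewrite Ht in Ha; lra. }
  2: { destruct (ring_hole_bounded q _ _ _ Hq ltac:(apply Nat.lt_le_incl; exact Hr) Hint) as [H _];
       simpl in H; lra. }
  all: destruct (pad_hole_bounds _ _ _ Hj Hint) as [_ [H _]]; simpl in H; lra.
Qed.

(** The value [q = 0] covers [h < 8], where all holes are padding. *)
Lemma cube_root_floor (h : nat) :
  exists q, (ring_count q <= h)%nat /\ (h < ring_count (S q))%nat.
Proof.
  induction h as [|h [q [H1 H2]]].
  - exists 0%nat; unfold ring_count; lia.
  - destruct (Nat.lt_ge_cases (S h) (ring_count (S q))) as [Hlt|Hge].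
    + exists q; lia.
    + exists (S q); split; auto. unfold ring_count in *; nia.
Qed.

(** The constant combines [geod >= (q + 1) / 20], a diameter of at most 40, and [h < 8 (q + 1)^3],
    so that the cube root of [h] is at most [2 (q + 1)]. *)
Lemma g_lower (h : nat) : (1 <= h)%nat -> Rbar_le (Finite (/ 1600 * Rpower (INR h) (1 / 3))) (g h).
Proof.
  intros Hh; destruct (cube_root_floor h) as [q [Hq1 Hq2]].
  pose proof (pos_INR q) as HqR.
  assert (Hroot : Rpower (INR h) (1 / 3) <= 2 * (INR q + 1)).
  { assert (HX : 0 < 2 * (INR q + 1)) by lra.
    replace (2 * (INR q + 1)) with (Rpower ((2 * (INR q + 1)) ^ 3) (1 / 3)).
    - apply Rle_Rpower_l; [lra|]; split; [apply lt_0_INR; lia|].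
      apply Nat.lt_le_incl, le_INR in Hq2; unfold ring_count in Hq2.
      rewrite !mult_INR, (S_INR q) in Hq2; replace (INR 8) with 8 in Hq2 by (simpl; ring); lra.
    - rewrite <- Rpower_pow, Rpower_mult by auto.
      replace (INR 3 * (1 / 3)) with 1 by (simpl; field); apply Rpower_1; auto. }
  destruct (source_target_in_domain q h) as [Hs Ht].
  set (P := ringed_domain q h) in *.
  destruct (diam2_finite P 40 source target) as (D & HD & HD40 & HDm); auto.
  { intros x y [[Hx1 Hx2] _] [[Hy1 Hy2] _].
    rewrite lin_dir_0 in Hx1, Hy1; rewrite lin_nrm_0 in Hx2, Hy2.
    eapply Rle_trans; [apply dist_le_l1|].
    replace 40 with (20 + 20) by ring; apply Rplus_le_compat; apply Rabs_le; lra. }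
  assert (HDpos : 0 < D).
  { eapply Rlt_le_trans; [|apply (HDm source target Hs Ht)].
    eapply Rlt_le_trans; [|apply abs_fst_le_dist]. simpl; rewrite Rabs_pos_eq; lra. }
  assert (Hgeod : Rbar_le (Finite ((INR q + 1) / 20)) (geod P source target)).
  { unfold geod; apply Glb_Rbar_correct; intros r [l [Hl ->]]; simpl.
    apply (ringed_domain_path_length q h); auto. }
  assert (Hdg : Rbar_le (Finite ((INR q + 1) / 20)) (diamg P)).
  { unfold diamg; apply Lub_Rbar_correct; exists source, target; auto. }
  apply Rbar_le_trans with (Finite ((INR q + 1) / 20 * / D)).
  { simpl. assert (Hinv : / 40 <= / D) by (apply Rinv_le_contravar; auto).
    assert (0 <= (INR q + 1) / 20) by lra. nra. }
  unfold g; apply Lub_Rbar_correct; exists P; split; [apply ringed_domain_in_C|].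
  unfold distortion; rewrite HD; simpl real.
  assert (Hinv : 0 < / D) by (apply Rinv_0_lt_compat; auto).
  destruct (diamg P) as [x| |]; simpl in Hdg.
  - simpl; apply Rmult_le_compat_r; lra.
  - simpl. destruct (Rle_dec 0 (/ D)) as [Hle|]; [|lra].
    destruct (Rle_lt_or_eq_dec 0 (/ D) Hle); simpl; auto; lra.
  - destruct Hdg.
Qed.

Theorem theorem1 :
  exists c1 c2 : R, 0 < c1 /\ 0 < c2 /\
    forall h : nat, (1 <= h)%nat ->
      Rbar_le (Finite (c1 * Rpower (INR h) (1 / 3))) (g h) /\
      Rbar_le (g h) (Finite (c2 * sqrt (INR h))).
Proof.
  exists (/ 1600), 70; split; [lra|]; split; [lra|]; intros h Hh.
  split; [apply g_lower; auto|apply g_upper; auto].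
Qed.
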